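(* Let $k$ be an algebraically closed field of characteristic $p=2$, let $\mathbb{H}=k((y^{\mathbb{Q}}))$ be the Hahn field with its valuation $v$, and let $K$ be a field with $k(y)\subseteq K\subseteq\mathbb{H}$ such that $(K,v)$ is Henselian, $K$ is perfect, and $K$ has no finite limits. Let $$\alpha=\sum_{n=1}^\infty y^{-1/2^n},\qquad \eta=\sum_{n=1}^\infty (y^{-1}\alpha)^{1/2^n}\in\mathbb{H},$$ so that $\alpha^2-\alpha=y^{-1}$ and $\eta^2+\eta=y^{-1}\alpha$, and let $L=K(\alpha)$, $M=L(\eta)$. Then $\mathrm{depth}(M/K,v)=2$.
   Context: $\mathbb{H}$ is the field of formal series $s=\sum_{q\in\mathbb{Q}}\lambda_qy^q$, $\lambda_q\in k$, with well-ordered support $\mathrm{supp}(s)=\{q\mid\lambda_q\neq0\}$, and $v(s)=\min\mathrm{supp}(s)$. $K$ has no finite limits if for every $a\in K$ the set $\mathrm{supp}(a)$ has no accumulation point in $\mathbb{R}$ (so $\mathrm{supp}(a)$ is finite or its only limit is $\infty$). $\overline{K}$ denotes the algebraic closure of $K$ in $\mathbb{H}$ and $\Gamma=v\overline{K}$. Depth. For $\theta\in\overline{K}$ of degree $n$ over $K$ and $1\le m\le n$, let $D_m(\theta)=\{v(\theta-b)\mid b\in\overline{K},\ \deg_K b=m\}\subseteq\Gamma\cup\{\infty\}$. Define integers $1=d_0<d_1<\cdots<d_r=n$ by $d_0=1$ and, as long as $d_{\ell-1}<n$, $d_\ell$ is the least integer $m>d_{\ell-1}$ such that some $\epsilon\in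 D_m(\theta)$ satisfies $\epsilon>x$ for all $x\in D_{d_{\ell-1}}(\theta)$. Then $\mathrm{depth}(\theta):=r$. (Originally, depth is defined as the common length of the Mac Lane–Vaquié chains of the valuation $f\mapsto v(f(\theta))$ on $K[x]$; by a known theorem it equals this $r$, which may be taken as the definition.) For a finite simple extension $M/K$ inside $\overline{K}$, $\mathrm{depth}(M/K,v):=\min\{\mathrm{depth}(\theta)\mid M=K(\theta)\}$. *)

(* Defs.v *)
From HB Require Import structures.
From mathcomp Require Import all_boot all_order all_algebra finmap ring lra.
From mathcomp Require Import mathcomp_extra boolp classical_sets functions.
From mathcomp Require Import cardinality fsbigop constructive_ereal reals.
From mathcomp Require Import topology normedtype.

Set Implicit Arguments.
Unset Strict Implicit.
Unset Printing Implicit Defensive.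

Import Order.TTheory GRing.Theory Num.Theory.
Import numFieldNormedType.Exports.

Local Open Scope classical_set_scope.
Local Open Scope ring_scope.

Definition well_ordered (A : set rat) : Prop :=
  forall B : set rat, B `<=` A -> B !=set0 ->
    exists2 m, B m & forall x, B x -> m <= x.

Section WellOrdered.
Implicit Types (A B : set rat).

Lemma wo_sub A B : A `<=` B -> well_ordered B -> well_ordered A.
Proof. by move=> AB wB C CA; apply: wB; apply: subset_trans AB. Qed.

Lemma wo_nodecr A (c : nat -> rat) :
  well_ordered A -> (forall n, A (c n)) -> ~ (forall n, c n.+1 < c n).
Proof.
move=> wA Ac dec.
have [||m [n _ <-] mP] := wA (range c).
- by move=> _ [n _ <-].
- by exists (c 0%N), 0%N.
by have := mP _ (imageT c n.+1); rewrite leNgt dec.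
Qed.

Lemma nodecr_wo A :
  (forall c : nat -> rat, (forall n, A (c n)) -> ~ (forall n, c n.+1 < c n)) ->
  well_ordered A.
Proof.
move=> noA B BA [x0 Bx0]; apply: contrapT => nomin.
have /choice[g gP] : forall x, exists y, B x -> B y /\ y < x.
  move=> x; have [Bx|nBx] := pselect (B x); last by exists x.
  apply: contrapT => /forallNP nx; apply: nomin; exists x => // y By.
  by rewrite leNgt; apply/negP => yx; apply: (nx y).
have Bc n : B (iter n g x0) by elim: n => //= n /gP[].
by apply: (noA (fun n => iter n g x0)) => n; [apply: BA | case/gP: (Bc n)].
Qed.

Lemma wo_monoseq A (u : nat -> rat) : well_ordered A -> (forall n, A (u n)) ->
  exists phi : nat -> nat,
    (forall i, (phi i < phi i.+1)%N) /\ (forall i, u (phi i) <= u (phi i.+1)).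
Proof.
move=> wA Au.
have /choice[f fP] : forall N, exists m, (N < m)%N /\
    forall j, (N < j)%N -> u m <= u j.
  move=> N; have [||m [n Nn <-] mP] := wA (u @` [set n | (N < n)%N]).
  - by move=> _ [n _ <-].
  - by exists (u N.+1), N.+1 => /=.
  by exists n; split=> // j Nj; apply: mP; exists j.
exists (fun i => iter i.+1 f 0%N); split=> i; first exact: (fP _).1.
rewrite [in leLHS]iterS; apply: (fP _).2.
by apply: (@ltn_trans (iter i.+1 f 0%N)); [exact: (fP _).1 | exact: (fP _).1].
Qed.

Lemma wo_addset A B : well_ordered A -> well_ordered B ->
  well_ordered [set x | exists a b, [/\ A a, B b & x = a + b]].
Proof.
move=> wA wB; apply: nodecr_wo => c cAB dec.
have /choice[a aP] : forall n, exists a, A a /\ B (c n - a).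
  by move=> n; have [a [b [Aa Bb ->]]] := cAB n; exists a; rewrite addrC addKr.
have [phi [phiS aphi]] := wo_monoseq wA (fun n => (aP n).1).
have decle n m : (n < m)%N -> c m < c n.
  by elim: m => // m IH; rewrite ltnS leq_eqVlt => /predU1P[->//|/IH]; apply: lt_trans.
apply: (wo_nodecr wB (fun i => (aP (phi i)).2)) => i.
by rewrite ltr_leB// decle.
Qed.

Lemma wo_setU A B : well_ordered A -> well_ordered B -> well_ordered (A `|` B).
Proof.
move=> wA wB C CAB [x Cx].
have [[a [Ca Aa]]|noA] := pselect ((C `&` A) !=set0); last first.
  apply: wB; last by exists x.
  by move=> y Cy; have [Ay|//] := CAB _ Cy; case: noA; exists y.
have [[b [Cb Bb]]|noB] := pselect ((C `&` B) !=set0); last first.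
  apply: wA; last by exists x.
  by move=> y Cy; have [//|By] := CAB _ Cy; case: noB; exists y.
have [|m [Cm Am] mP] := wA (C `&` A) (@subIsetr _ _ _); first by exists a.
have [|n [Cn Bn] nP] := wB (C `&` B) (@subIsetr _ _ _); first by exists b.
have [mn|nm] := leP m n.
- exists m => // y Cy; have [Ay|By] := CAB _ Cy; first by apply: mP.
  by apply: le_trans mn _; apply: nP.
- exists n => // y Cy; have [Ay|By] := CAB _ Cy; last by apply: nP.
  by apply: le_trans (ltW nm) _; apply: mP.
Qed.

Lemma wo_set0 : well_ordered set0.
Proof. by move=> B B0 [x /B0]. Qed.

Lemma wo_set1 (q : rat) : well_ordered [set q].
Proof.
by move=> B Bq [x Bx]; exists x => // y By; rewrite (Bq _ Bx) (Bq _ By).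
Qed.

Lemma wo_local A :
  (forall x, well_ordered (A `&` [set y | y <= x])) -> well_ordered A.
Proof.
move=> wA B BA [x Bx].
have [|m [Bm mx] mP] := wA x (B `&` [set y | y <= x]) (@setSI _ _ _ _ BA).
  by exists x; split=> /=.
exists m => // y By; have [yx|xy] := leP y x; first by apply: mP.
by apply: le_trans mx (ltW xy).
Qed.

Lemma finite_conv A B q : well_ordered A -> well_ordered B ->
  finite_set [set a | A a /\ B (q - a)].
Proof.
move=> wA wB; apply: contrapT => /infiniteP/ppcard_leP[f].
have fP n : A (f n) /\ B (q - f n) by have := 'funS_f (I : [set: nat] n).
have [phi [phiS fphi]] := wo_monoseq wA (fun n => (fP n).1).
apply: (wo_nodecr wB (fun i => (fP (phi i)).2)) => i.
rewrite ltrD2l ltrN2 lt_neqAle fphi andbT; apply/eqP => e.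
have /eqP := 'inj_f (mem_setT _) (mem_setT _) e.
by rewrite ltn_eqF.
Qed.

End WellOrdered.

Section HahnDef.
Variable k : fieldType.

(* The Hahn field k((y^Q)): an element is its coefficient function, s q being the
   coefficient of y^q. *)
Record hahn := Hahn {
  hcoef :> rat -> k;
  hcoef_wo : well_ordered [set q | hcoef q != 0] }.
Arguments hcoef_wo : clear implicits.

Definition hsupp (s : hahn) : set rat := [set q | s q != 0].

Lemma hahnP (s t : hahn) : s =1 t -> s = t.
Proof.
case: s t => [s sw] [t tw] /= /funext e; move: sw tw; rewrite e => sw tw.
by congr Hahn; apply: Prop_irrelevance.
Qed.

HB.instance Definition _ := gen_eqMixin hahn.
HB.instance Definition _ := gen_choiceMixin hahn.

Lemma hzero_wo : well_ordered [set q | (fun _ : rat => 0 : k) q != 0].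
Proof. by apply: (wo_sub _ wo_set0) => q /=; rewrite eqxx. Qed.
Definition hzero := Hahn hzero_wo.

Lemma hopp_wo (s : hahn) : well_ordered [set q | (fun q => - s q) q != 0].
Proof. by apply: (wo_sub _ (hcoef_wo s)) => q /=; rewrite oppr_eq0. Qed.
Definition hopp s := Hahn (@hopp_wo s).

Lemma hadd_wo (s t : hahn) : well_ordered [set q | (fun q => s q + t q) q != 0].
Proof.
apply: (wo_sub _ (wo_setU (hcoef_wo s) (hcoef_wo t))) => q /=.
by have [->|] := eqVneq (s q) 0; [rewrite add0r; right | left].
Qed.
Definition hadd s t := Hahn (@hadd_wo s t).

Lemma haddA : associative hadd.
Proof. by move=> s t u; apply: hahnP => q /=; rewrite addrA. Qed.
Lemma haddC : commutative hadd.
Proof. by move=> s t; apply: hahnP => q /=; rewrite addrC. Qed.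
Lemma hadd0 : left_id hzero hadd.
Proof. by move=> s; apply: hahnP => q /=; rewrite add0r. Qed.
Lemma haddN : left_inverse hzero hopp hadd.
Proof. by move=> s; apply: hahnP => q /=; rewrite addNr. Qed.

HB.instance Definition _ := GRing.isZmodule.Build hahn haddA haddC hadd0 haddN.

Lemma hcoef0 q : (0 : hahn) q = 0. Proof. by []. Qed.
Lemma hcoefD (s t : hahn) q : (s + t) q = s q + t q. Proof. by []. Qed.
Lemma hcoefN (s : hahn) q : (- s) q = - s q. Proof. by []. Qed.
Lemma hcoefB (s t : hahn) q : (s - t) q = s q - t q. Proof. by []. Qed.

Lemma hmono_wo (c : k) (e : rat) :
  well_ordered [set q | (fun q => if q == e then c else 0) q != 0].
Proof.
apply: (wo_sub _ (@wo_set1 e)) => q /=.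
by case: (q =P e) => // _; rewrite eqxx.
Qed.
(* c y^e *)
Definition hmono c e := Hahn (@hmono_wo c e).

(* Only finitely many terms are nonzero, by finite_conv. *)
Definition mulcoef (s t : hahn) (q : rat) : k :=
  \sum_(a \in [set: rat]) s a * t (q - a).

Lemma hmul_wo (s t : hahn) : well_ordered [set q | mulcoef s t q != 0].
Proof.
apply: (wo_sub _ (wo_addset (hcoef_wo s) (hcoef_wo t))) => q /=.
apply: contra_neqP => nq; rewrite /mulcoef fsbig1// => a _.
have [->|sa] := eqVneq (s a) 0; first by rewrite mul0r.
have [->|tqa] := eqVneq (t (q - a)) 0; first by rewrite mulr0.
by case: nq => //; exists a, (q - a); rewrite subrKC.
Qed.
Definition hmul s t := Hahn (@hmul_wo s t).

Lemma hmul_seq (X : seq rat) (s t : hahn) q : uniq X ->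
  (forall a, s a != 0 -> t (q - a) != 0 -> a \in X) ->
  hmul s t q = \sum_(a <- X) s a * t (q - a).
Proof.
move=> uX XP; rewrite /= /mulcoef (fsbigE X)//.
  by apply: eq_bigl => a; rewrite in_setT.
move=> a _ aX; have [->|sa] := eqVneq (s a) 0; first by rewrite mul0r.
have [->|tqa] := eqVneq (t (q - a)) 0; first by rewrite mulr0.
by rewrite (XP a) in aX.
Qed.

Lemma conv_seq (A B : set rat) q : well_ordered A -> well_ordered B ->
  exists2 X : seq rat, uniq X & forall a, (a \in X) <-> (A a /\ B (q - a)).
Proof.
move=> wA wB; have /finite_seqP[X XE] := finite_conv q wA wB.
exists (undup X); first exact: undup_uniq.
move=> a; rewrite mem_undup; have /(congr1 (@^~ a)) /= <- // := XE.
Qed.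

Lemma hmulC : commutative hmul.
Proof.
move=> s t; apply: hahnP => q.
have [X uX XP] := conv_seq q (hcoef_wo s) (hcoef_wo t).
rewrite (hmul_seq uX); last by move=> a sa ta; apply/XP.
rewrite (@hmul_seq [seq q - a | a <- X]).
- by rewrite big_map; apply: eq_bigr => a _; rewrite mulrC subKr.
- by rewrite map_inj_uniq// => a b /addrI/oppr_inj.
- move=> a ta sa; apply/mapP; exists (q - a); last by rewrite subKr.
  by apply/XP; rewrite /= subKr.
Qed.

Lemma hmulA : associative hmul.
Proof.
move=> s t u; apply: hahnP => q.
have [X uX XP] := conv_seq q (hcoef_wo s)
  (wo_addset (hcoef_wo t) (hcoef_wo u)).
have [Z uZ ZP] := conv_seq q (hcoef_wo u)
  (wo_addset (hcoef_wo s) (hcoef_wo t)).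
have inX a b c : s a != 0 -> t b != 0 -> u c != 0 -> q = a + b + c -> a \in X.
  move=> sa tb uc e; apply/XP; split=> //=; exists b, c; split=> //.
  by rewrite e; ring.
have inZ a b c : s a != 0 -> t b != 0 -> u c != 0 -> q = a + b + c -> c \in Z.
  move=> sa tb uc e; apply/ZP; split=> //=; exists a, b; split=> //.
  by rewrite e addrK.
have nz (v w : hahn) r : hmul v w r != 0 ->
    exists a b, [/\ v a != 0, w b != 0 & r = a + b].
  apply: contra_neqP => nq; rewrite /= /mulcoef fsbig1// => a _.
  have [->|sa] := eqVneq (v a) 0; first by rewrite mul0r.
  have [->|tqa] := eqVneq (w (r - a)) 0; first by rewrite mulr0.
  by case: nq => //; exists a, (r - a); rewrite subrKC.
rewrite (hmul_seq uX); last first.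
  move=> a sa /nz[b [c [tb uc e]]]; apply: (inX a b c) => //.
  by rewrite -addrA -e addrC subrK.
rewrite [RHS](_ : _ = hmul u (hmul s t) q); last by rewrite hmulC.
rewrite (hmul_seq uZ); last first.
  move=> c uc /nz[a [b [sa tb e]]]; apply: (inZ a b c) => //.
  by rewrite -e subrK.
under eq_big_seq => a aX.
  rewrite hmulC (hmul_seq uZ); last first.
    move=> c uc tb; have /XP[/= sa _] := aX.
    by apply: (inZ a (q - a - c) c) => //; ring.
  rewrite mulr_sumr; over.
rewrite exchange_big; apply: eq_big_seq => c cZ.
rewrite (hmul_seq uX); last first.
  move=> a sa tb; have /ZP[/= uc _] := cZ.
  by apply: (inX a (q - c - a) c) => //; ring.
rewrite mulr_sumr; apply: eq_bigr => a _.
by rewrite mulrCA addrAC.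
Qed.

Lemma hmonoM c e (s : hahn) q : hmul (hmono c e) s q = c * s (q - e).
Proof.
rewrite (@hmul_seq [:: e])//; last first.
  by move=> a; rewrite inE /=; case: (a == e); rewrite ?eqxx.
by rewrite big_seq1 /= eqxx.
Qed.

Lemma hmul1 : left_id (hmono 1 0) hmul.
Proof. by move=> s; apply: hahnP => q; rewrite hmonoM mul1r subr0. Qed.

Lemma hmulDl : left_distributive hmul hadd.
Proof.
move=> s t u; apply: hahnP => q.
have [X uX XP] := conv_seq q (wo_setU (hcoef_wo s) (hcoef_wo t)) (hcoef_wo u).
have -> : hadd (hmul s u) (hmul t u) q = hmul s u q + hmul t u q by [].
rewrite (@hmul_seq X (hadd s t))//; last first.
  move=> a sta ua; apply/XP; split=> //=.
  by move: sta => /=; have [->|] := eqVneq (s a) 0; [rewrite add0r; right | left].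
rewrite (@hmul_seq X s)//; last by move=> a sa ua; apply/XP; split=> //; left.
rewrite (@hmul_seq X t)//; last by move=> a sa ua; apply/XP; split=> //; right.
by rewrite -big_split; apply: eq_bigr => a _; rewrite /= mulrDl.
Qed.

Lemma hone_neq0 : hmono 1 0 != 0 :> hahn.
Proof.
apply/eqP => /(congr1 (fun s : hahn => s 0)) /= /eqP.
by rewrite oner_eq0.
Qed.

HB.instance Definition _ :=
  GRing.Zmodule_isComNzRing.Build hahn hmulA hmulC hmul1 hmulDl hone_neq0.

Lemma hcoefM (s t : hahn) q :
  (s * t) q = \sum_(a \in [set: rat]) s a * t (q - a).
Proof. by []. Qed.

Lemma hcoef1 q : (1 : hahn) q = (q == 0)%:R.
Proof. by rewrite /=; case: eqP. Qed.

Lemma hcoef_monoM c e (s : hahn) q : (hmono c e * s) q = c * s (q - e).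
Proof. exact: hmonoM. Qed.

Lemma hmono_mul c e d f : hmono c e * hmono d f = hmono (c * d) (e + f) :> hahn.
Proof.
apply: hahnP => q; rewrite hcoef_monoM /= subr_eq [f + e]addrC.
by case: eqP => // _; rewrite mulr0.
Qed.

Lemma hcoef_sum (I : Type) (r : seq I) (P : pred I) (F : I -> hahn) q :
  (\sum_(i <- r | P i) F i) q = \sum_(i <- r | P i) F i q.
Proof. by apply: (big_morph (fun s : hahn => s q)). Qed.

Lemma hcoefM_neq0 (s t : hahn) q : (s * t) q != 0 ->
  exists a b, [/\ s a != 0, t b != 0 & q = a + b].
Proof.
rewrite hcoefM; apply: contra_neqP => nq; rewrite fsbig1// => a _.
have [->|sa] := eqVneq (s a) 0; first by rewrite mul0r.
have [->|tqa] := eqVneq (t (q - a)) 0; first by rewrite mulr0.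
by case: nq => //; exists a, (q - a); rewrite subrKC.
Qed.

Lemma hmin (s : hahn) : s != 0 ->
  exists2 m, s m != 0 & forall q, s q != 0 -> m <= q.
Proof.
move=> s0; apply: (hcoef_wo s) => //.
apply: contrapT => ns; move/eqP: s0; apply; apply: hahnP => q.
by apply: contrapT => /eqP sq; apply: ns; exists q.
Qed.

Lemma geom_inv (e : hahn) : (forall q, e q != 0 -> 0 < q) ->
  exists t, t * (1 - e) = 1.
Proof.
move=> epos; have [->|e0] := eqVneq e 0; first by exists 1; rewrite subr0 mulr1.
have [m em mP] := hmin e0; have m0 := epos _ em.
have eX n q : (e ^+ n) q != 0 -> n%:R * m <= q.
  elim: n q => [|n IH] q.
    by by rewrite expr0 mul0r hcoef1; case: (eqVneq q 0) => [->//|]; rewrite eqxx.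
  rewrite exprS => /hcoefM_neq0[a [b [/mP am /IH bm ->]]].
  by rewrite -natr1 mulrDl mul1r addrC lerD.
pose T n : hahn := \sum_(i < n) e ^+ i.
have Tst q n n' : q < n%:R * m -> (n <= n')%N -> T n' q = T n q.
  move=> qn; elim: n' => [|n' IH]; first by rewrite leqn0 => /eqP->.
  rewrite leq_eqVlt => /predU1P[->//|]; rewrite ltnS => nn'.
  rewrite /T big_ord_recr hcoefD -/(T n') IH// -[RHS]addr0; congr +%R.
  apply/eqP; apply/contraT => /eX; rewrite leNgt (lt_le_trans qn)//.
  by rewrite ler_pM2r// ler_nat.
have bP q : exists n : nat, q < n%:R * m.
  exists (Num.bound `|q / m|); rewrite -ltr_pdivrMr//.
  by apply: le_lt_trans (ler_norm _) _; apply: archi_boundP.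
have /choice[N NP] := bP.
pose tc q := T (N q) q.
have tcE q n : q < n%:R * m -> tc q = T n q.
  move=> qn; rewrite /tc; case/orP: (leq_total n (N q)) => le.
    exact: Tst.
  by rewrite [RHS](Tst _ (N q)).
have twf : well_ordered [set q | tc q != 0].
  apply: wo_local => x; apply: (wo_sub _ (hcoef_wo (T (N x)))) => q /= [+ qx].
  by rewrite (tcE q (N x))// (le_lt_trans qx).
exists (Hahn twf); rewrite mulrC; apply: hahnP => q.
have -> : (1 : hahn) q = ((1 - e) * T (N q)) q.
  have -> : (1 - e) * T (N q) = 1 - e ^+ N q.
    by rewrite -opprB -[1 - e ^+ _]opprB subrX1 mulNr.
  rewrite hcoefB -[LHS]subr0; congr (_ - _); apply/esym/eqP.
  by apply/contraT => /eX; rewrite leNgt NP.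
rewrite !hcoefM; apply: eq_fsbigr => a _.
change ((1 - e) a * tc (q - a) = (1 - e) a * T (N q) (q - a)).
have [->|ea] := eqVneq ((1 - e) a) 0; first by rewrite !mul0r.
congr (_ * _); apply: tcE; apply: le_lt_trans (NP q).
rewrite gerBl; move: ea; rewrite hcoefB hcoef1; case: (eqVneq a 0) => [->//|_].
by rewrite sub0r oppr_eq0 => /epos/ltW.
Qed.

Lemma hinv_ex (s : hahn) : s != 0 -> exists t, t * s = 1.
Proof.
move=> s0; have [m sm mP] := hmin s0.
pose x := hmono (s m)^-1 (- m) * s.
have [|t tP] := @geom_inv (1 - x).
  move=> q; rewrite hcoefB hcoef1 hcoef_monoM opprK.
  have [->|q0] := eqVneq q 0; first by rewrite add0r mulVf ?subrr ?eqxx.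
  rewrite sub0r oppr_eq0 mulf_eq0 negb_or => /andP[_ /mP].
  by rewrite -{1}[m]add0r lerD2r lt_neqAle eq_sym q0.
exists (t * hmono (s m)^-1 (- m)).
by rewrite -mulrA -/x -tP opprB addrC subrK.
Qed.

Definition hinv (s : hahn) : hahn := xget 0 [set t | t * s = 1].

Lemma hmulVf s : s != 0 -> hinv s * s = 1.
Proof. by move=> /hinv_ex ex; exact: (xgetPex 0 ex). Qed.

Lemma hinv0 : hinv 0 = 0.
Proof.
apply: xgetPN => t /=; rewrite mulr0 => /esym/eqP.
by rewrite oner_eq0.
Qed.

HB.instance Definition _ := GRing.ComNzRing_isField.Build hahn hmulVf hinv0.

End HahnDef.

Arguments hcoef_wo {k} h : rename.

Notation "{ 'hahn' k }" := (hahn k) (format "{ 'hahn'  k }") : type_scope.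

(* The minimum of P, or 0 when P is empty. *)
Definition least (P : set nat) : nat :=
  xget 0%N [set m | P m /\ forall n, P n -> (m <= n)%N].

Section Subfields.
Variable F : fieldType.
Implicit Types (K : {pred F}) (S : set F) (x : F).

(* Subfields are predicates with a divringClosed structure. *)
Definition gen_field S : {pred F} := fun x =>
  `[< forall E : divringClosed F, S `<=` [set` E] -> x \in E >].

Lemma gen_field_divring_closed S : divring_closed (gen_field S).
Proof.
split=> [|x z|x z]; rewrite !inE.
- by move=> E _; apply: rpred1.
- by move=> Sx Sz E SE; apply: rpredB; [apply: Sx | apply: Sz].
- by move=> Sx Sz E SE; apply: rpred_div; [apply: Sx | apply: Sz].
Qed.

HB.instance Definition _ S := GRing.isDivringClosed.Build F (gen_field S)
  (gen_field_divring_closed S).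

(* K(x) *)
Definition adjoin K x : {pred F} := gen_field ([set` K] `|` [set x]).

HB.instance Definition _ K x := GRing.DivringClosed.on (adjoin K x).

Definition algebraic_over K x : Prop :=
  exists f, [/\ f \is a polyOver K, f != 0 & root f x].

(* The degree of x over K, or 0 when x is transcendental over K. *)
Definition degree_over K x : nat := least
  [set n | exists f, [/\ f \is a polyOver K, f != 0, size f = n.+1 & root f x]].

(* F has characteristic 0 or every element of K has a p-th root in K. *)
Definition perfect_field K : Prop :=
  forall p, p \in [pchar F] -> forall x, x \in K -> exists2 z, z \in K & z ^+ p = x.

End Subfields.

Section Valuation.
Variable k : fieldType.
Implicit Types (K M : {pred {hahn k}}) (s a theta : {hahn k}).

Definition hval s : \bar rat :=
  if s == 0 then +oo%E
  else (xget 0 [set m | s m != 0 /\ forall q, s q != 0 -> m <= q])%:E.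

(* k(y), as a subfield of k((y^Q)). *)
Definition kY : {pred {hahn k}} :=
  gen_field (range (fun c : k => hmono c 0) `|` [set hmono 1 1]).

HB.instance Definition _ := GRing.DivringClosed.on kY.

Definition val_ring K : set {hahn k} := [set a | a \in K /\ (0 <= hval a)%E].

(* A simple root of f in the residue field lifts to a root of f in K. *)
Definition henselian K : Prop :=
  forall (f : {poly {hahn k}}) a, (forall i, val_ring K f`_i) -> val_ring K a ->
    (0 < hval f.[a])%E -> hval f^`().[a] = 0%E ->
    exists b, [/\ val_ring K b, root f b & (0 < hval (b - a)%R)%E].

Definition no_finite_limits (R : realType) K : Prop :=
  forall a, a \in K -> limit_point ((@ratr R) @` hsupp a) = set0.

(* For b = theta the value is v(0) = +oo. *)
Definition Dset K theta (m : nat) : set (\bar rat) :=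
  [set hval (theta - b) | b in
    [set b | algebraic_over K b /\ degree_over K b = m]].

Definition next_d K theta (d : nat) : nat := least
  [set m | (d < m)%N /\
     exists2 e, Dset K theta m e & forall x, Dset K theta d x -> (x < e)%E].

(* With d_l = iter l (next_d K theta) 1, the least r such that d_r is the
   degree of theta. *)
Definition depth K theta : nat :=
  least [set r | iter r (next_d K theta) 1%N = degree_over K theta].

Definition depth_ext K M : nat := least
  [set r | exists theta,
     [/\ algebraic_over K theta, adjoin K theta =i M & depth K theta = r]].

End Valuation.
Arguments kY : clear implicits.

Section Sums.
Variable k : fieldType.
Implicit Types (u : nat -> {hahn k}) (s t : {hahn k}).

(* The family u is summable, with sum s. *)
Definition is_hsum u s : Prop :=
  [/\ well_ordered (\bigcup_n hsupp (u n)),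
      forall q, finite_set [set n | u n q != 0] &
      forall q, s q = \sum_(n \in [set: nat]) u n q].

Definition hsum u : {hahn k} := xget 0 (is_hsum u).

(* For n a power of the characteristic there is at most one n-th root. *)
Definition hroot (n : nat) s : {hahn k} := xget 0 [set t | t ^+ n = s].

(* The index n of alpha and eta starts at 0, hence the shifts n.+1. *)
Definition alpha : {hahn k} := hsum (fun n => hmono 1 (- (2 ^- n.+1))).

Definition eta : {hahn k} :=
  hsum (fun n => hroot (2 ^ n.+1) (hmono 1 (- 1) * alpha)).

Lemma is_hsum_uniq u s t : is_hsum u s -> is_hsum u t -> s = t.
Proof. by move=> [_ _ sE] [_ _ tE]; apply: hahnP => q; rewrite sE tE. Qed.

Lemma is_hsum_hsum u : well_ordered (\bigcup_n hsupp (u n)) ->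
  (forall q, finite_set [set n | u n q != 0]) -> is_hsum u (hsum u).
Proof.
move=> wu fu; apply: (@xgetPex _ 0 (is_hsum u)).
pose c q := \sum_(n \in [set: nat]) u n q.
have wc : well_ordered [set q | c q != 0].
  apply: (wo_sub _ wu) => q /=; apply: contra_neqP => nq.
  rewrite /c fsbig1// => n _; apply/eqP/negPn/negP => unq.
  by apply: nq; exists n.
by exists (Hahn wc); split.
Qed.

Lemma is_hsum_cons u s t :
  is_hsum u s -> is_hsum (fun n => if n is m.+1 then u m else t) (t + s).
Proof.
move=> [wu fu sE]; split.
- apply: (wo_sub _ (wo_setU (hcoef_wo t) wu)) => q [[|n] _ nq]; first by left.
  by right; exists n.
- move=> q; apply: (@sub_finite_set _ _ ([set 0%N] `|` succn @` [set n | u n q != 0])).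
    by move=> [|n] nq; [left | right; exists n].
  by rewrite finite_setU; split=> //; apply: finite_image.
- move=> q; rewrite hcoefD sE.
  have /finite_seqP[X0 X0E] := fu q; pose X := undup X0.
  have uX : uniq X by apply: undup_uniq.
  have XP n : n \notin X -> u n q = 0.
    rewrite mem_undup => nX; apply/eqP; apply: contraNT nX => nz.
    by have /(congr1 (@^~ n)) /= <- := X0E.
  rewrite (fsbigE X)//; last by move=> n _ /XP.
  rewrite (fsbigE (0%N :: map succn X)); last 3 first.
  + rewrite /= map_inj_uniq ?uX ?andbT; last exact: succn_inj.
    by apply/mapP => -[].
  + by [].
  + move=> [|n] _; rewrite in_cons //= mem_map; last exact: succn_inj.
    by move=> /XP.
  by rewrite big_cons in_setT big_map; congr (_ + _).
Qed.

End Sums.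

Section Char2.
Variable k : fieldType.
Hypothesis k2 : 2%N \in [pchar k].
Implicit Types (u : nat -> {hahn k}) (s t : {hahn k}).

Lemma hpchar2 : 2%N \in [pchar {hahn k}].
Proof.
apply/andP; split=> //; apply/eqP/hahnP => q.
by rewrite mulr2n hcoefD addrr_pchar2.
Qed.

Lemma hcoef_sqr s q : (s ^+ 2) q = (s (q / 2)) ^+ 2.
Proof.
have [X0 uX0 X0P] := conv_seq q (hcoef_wo s) (hcoef_wo s).
pose X := q / 2 :: [seq a <- X0 | a != q / 2].
have uX : uniq X by rewrite /= filter_uniq// mem_filter /= eqxx.
have half : q - q / 2 = q / 2 by field.
have Xsym a : a \in X -> q - a \in X.
  rewrite !in_cons => /predU1P[->|]; first by rewrite half eqxx.
  rewrite mem_filter => /andP[_ /X0P[sa sb]]; rewrite mem_filter /=.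
  case: eqP => //= _; apply/X0P; rewrite /= subKr //.
have Xperm : perm_eq X [seq q - a | a <- X].
  apply: uniq_perm => //.
    by rewrite map_inj_uniq// => a b /addrI/oppr_inj.
  move=> a; apply/idP/mapP => [aX|[b bX ->]]; last exact: Xsym.
  by exists (q - a); [apply: Xsym | rewrite subKr].
rewrite expr2 [LHS](@hmul_seq _ X)//; last first.
  move=> a sa sb; rewrite in_cons mem_filter /=.
  by case: eqP => //= _; apply/X0P.
rewrite (bigID (fun a => a < q - a)) /= [X in _ + X](bigID (fun a => a == q / 2)) /=.
have -> : \sum_(a <- X | ~~ (a < q - a) && (a == q / 2)) s a * s (q - a)
    = (s (q / 2)) ^+ 2.
  rewrite (eq_bigl (pred1 (q / 2))); last first.
    by move=> a /=; case: eqP => [->|]; rewrite ?half ?ltxx ?andbF.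
  by rewrite -big_filter filter_pred1_uniq ?mem_head// big_seq1 half expr2.
have -> : \sum_(a <- X | ~~ (a < q - a) && (a != q / 2)) s a * s (q - a)
    = \sum_(a <- X | a < q - a) s a * s (q - a).
  rewrite (perm_big _ Xperm) big_map; apply: eq_big => a; last first.
    by move=> _; rewrite subKr mulrC.
  rewrite subKr -leNgt; have -> : (q - a == q / 2) = (a == q / 2).
    by apply/eqP/eqP; lra.
  by apply/andP/idP => [[? /eqP ?]|?]; [|split; [|apply/eqP]]; lra.
by rewrite addrCA addrr_pchar2// addr0.
Qed.

Lemma hcoef_expr2n n s q : (s ^+ (2 ^ n)) q = (s (q / 2 ^+ n)) ^+ (2 ^ n).
Proof.
elim: n q => [|n IH] q; first by rewrite !expr1 divr1.
rewrite expnSr [in LHS]exprM hcoef_sqr IH -exprM; congr (s _ ^+ _).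
by rewrite exprS invfM mulrA.
Qed.

Lemma hsqr_inj s t : s ^+ 2 = t ^+ 2 -> s = t.
Proof.
move=> e; apply/eqP; rewrite -subr_eq0 -sqrf_eq0.
by rewrite -(pFrobenius_autE hpchar2) rmorphB /= !pFrobenius_autE e subrr.
Qed.

Lemma is_hsum_sqr u s : is_hsum u s -> is_hsum (fun n => u n ^+ 2) (s ^+ 2).
Proof.
move=> [wu fu sE]; split.
- move=> B Bu [x Bx].
  have [||m [b Bb <-] mP] := wu [set b / 2 | b in B].
  + move=> _ [b Bb <-]; have [n _ nb] := Bu _ Bb; exists n => //.
    have : (u n ^+ 2) b != 0 by exact: nb.
    by rewrite hcoef_sqr sqrf_eq0.
  + by exists (x / 2), x.
  exists b => // c Bc; have := mP (c / 2) (imageP _ Bc).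
  by rewrite ler_pM2r.
- move=> q; apply: sub_finite_set (fu (q / 2)) => n unq.
  have : (u n ^+ 2) q != 0 by exact: unq.
  by rewrite hcoef_sqr sqrf_eq0.
- move=> q; rewrite hcoef_sqr sE.
  have /finite_seqP[X0 X0E] := fu (q / 2); pose X := undup X0.
  have uX : uniq X by apply: undup_uniq.
  have XP n : n \notin X -> u n (q / 2) = 0.
    rewrite mem_undup => nX; apply/eqP; apply: contraNT nX => nz.
    by have /(congr1 (@^~ n)) /= <- := X0E.
  rewrite (fsbigE X)//; last by move=> n _ /XP.
  rewrite (fsbigE X)//; last by move=> n _ /XP; rewrite hcoef_sqr => ->; rewrite expr0n.
  rewrite -(pFrobenius_autE k2) rmorph_sum; apply: eq_bigr => n _.
  by rewrite hcoef_sqr; exact: pFrobenius_autE.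
Qed.

Lemma wo_dyadic : well_ordered (range (fun n => - (2 ^- n.+1) : rat)).
Proof.
move=> B Br [x Bx].
have [n0 _ n0x] := Br _ Bx.
have ex : exists n, `[< B (- (2 ^- n.+1)) >] by exists n0; apply/asboolP; rewrite n0x.
case: (ex_minnP ex) => n /asboolP Bn nP; exists (- (2 ^- n.+1)) => // z Bz.
have [m _ mz] := Br _ Bz; rewrite -mz lerN2 lef_pV2 ?posrE ?exprn_gt0//.
by rewrite ler_eXn2l// ltnS; apply: nP; apply/asboolP; rewrite mz.
Qed.

Lemma dyadic_inj : injective (fun n => - (2 ^- n.+1) : rat).
Proof.
move=> m n /oppr_inj/invr_inj; have := @ieexprIn rat 2 isT isT.
by move=> /(_ m.+1 n.+1) /[apply] -[].
Qed.

Lemma alpha_is_hsum : is_hsum (fun n => hmono 1 (- (2 ^- n.+1))) (alpha k).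
Proof.
apply: is_hsum_hsum => [|q].
- apply: (wo_sub _ wo_dyadic) => q [n _]; rewrite /hsupp /=.
  by case: (q =P _) => [-> _|_]; [exists n | rewrite eqxx].
- apply: sub_finite_set (finite_preimage (in2W dyadic_inj) (finite_set1 q)).
  by move=> n /=; case: (q =P _) => [-> //|_]; rewrite eqxx.
Qed.

Lemma alphaE : alpha k ^+ 2 - alpha k = hmono 1 (- 1).
Proof.
apply/eqP; rewrite subr_eq; apply/eqP.
apply: is_hsum_uniq (is_hsum_sqr alpha_is_hsum) _.
have := is_hsum_cons (hmono 1 (- 1)) alpha_is_hsum.
congr is_hsum; apply/funext => -[|n]; rewrite expr2 hmono_mul mulr1.
  by congr hmono; field.
by congr hmono; rewrite (exprS _ n.+1) invfM; set z := 2 ^- n.+1; field.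
Qed.

End Char2.

Section Eta.
Variable k : closedFieldType.
Hypothesis k2 : 2%N \in [pchar k].

Lemma hroot2nK n (s : {hahn k}) : hroot (2 ^ n) s ^+ (2 ^ n) = s.
Proof.
apply: (@xgetPex _ 0 [set t | t ^+ (2 ^ n) = s]).
have /choice[r rP] (c : k) : exists x, x ^+ (2 ^ n) = c.
  have [|x xP] := @solve_monicpoly k (2 ^ n)%N (fun i => if i == 0%N then c else 0).
    by rewrite expn_gt0.
  exists x; rewrite xP; have : (0 < 2 ^ n)%N by rewrite expn_gt0.
  case: (2 ^ n)%N => // m _; rewrite big_ord_recl /= mulr1 big1 ?addr0// => i _.
  by rewrite mul0r.
have r0 c : (r c == 0) = (c == 0).
  by rewrite -{2}(rP c) expf_eq0 expn_gt0.
have n0 : 0 < 2 ^+ n :> rat by rewrite exprn_gt0.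
pose c q := r (s (q * 2 ^+ n)).
have wc : well_ordered [set q | c q != 0].
  move=> B Bc [x Bx].
  have [||m [b Bb <-] mP] := hcoef_wo s [set b * 2 ^+ n | b in B].
  - by move=> _ [b Bb <-] /=; have /= := Bc _ Bb; rewrite r0.
  - by exists (x * 2 ^+ n), x.
  exists b => // d Bd; have := mP (d * 2 ^+ n) (imageP _ Bd).
  by rewrite ler_pM2r.
exists (Hahn wc); apply: hahnP => q.
by rewrite hcoef_expr2n//= /c rP divfK// gt_eqF.
Qed.

Lemma hexpr2n_inj n (s t : {hahn k}) : s ^+ (2 ^ n) = t ^+ (2 ^ n) -> s = t.
Proof.
elim: n s t => [|n IH] s t; first by rewrite !expr1.
by rewrite expnS !exprM => /IH; apply: hsqr_inj.
Qed.

Lemma eta_is_hsum : is_hsum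
  (fun n => hroot (2 ^ n.+1) (hmono 1 (- 1) * alpha k)) (eta k).
Proof.
set u := fun n => _.
have uP n q : u n q != 0 -> exists m, q = - (2 ^- n.+1) - (2 ^- (n + m).+2).
  move=> uq; have : (u n ^+ (2 ^ n.+1)) (q * 2 ^+ n.+1) != 0.
    by rewrite hcoef_expr2n// mulfK ?expf_neq0// expf_neq0.
  rewrite hroot2nK => /hcoefM_neq0[a [b [ha hb e]]].
  have {ha}ea : a = - 1.
    by move: ha => /=; case: (a =P - 1) => // _; rewrite eqxx.
  have [_ _ aE] := alpha_is_hsum k.
  have [m em] : exists m, b = - (2 ^- m.+1).
    apply: contrapT => /forallNP nb; move: hb; rewrite aE fsbig1 ?eqxx// => m _ /=.
    by case: eqP => // /nb.
  exists m; have z : 2 ^+ n.+1 != 0 :> rat by rewrite expf_neq0.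
  apply: (mulIf z); rewrite e ea em mulrBl mulNr mulVf//.
  rewrite -addnS -addSn exprD invfM mulrAC mulVf// mul1r //.
have wA := wo_dyadic.
apply: is_hsum_hsum => [|q].
- apply: (wo_sub _ (wo_addset wA wA)) => q [n _ /uP[m ->]].
  exists (- (2 ^- n.+1)), (- (2 ^- (n + m).+2)).
  by split; [exists n | exists (n + m).+1 |].
- apply: sub_finite_set
    (finite_preimage (in2W dyadic_inj) (finite_conv q wA wA)).
  move=> n /uP[m ->]; split; first by exists n.
  by exists (n + m).+1 => //; rewrite addrC addKr.
Qed.

Lemma etaE : eta k ^+ 2 + eta k = hmono 1 (- 1) * alpha k.
Proof.
apply/eqP; rewrite -[eta k in X in _ + X](oppr_pchar2 (hpchar2 k2)) subr_eq; apply/eqP.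
apply: is_hsum_uniq (is_hsum_sqr k2 eta_is_hsum) _.
have := is_hsum_cons (hmono 1 (- 1) * alpha k) eta_is_hsum.
congr is_hsum; apply/funext => -[|n].
  exact/esym/(hroot2nK 1).
apply: (@hexpr2n_inj n.+1); rewrite hroot2nK -exprM -expnS.
by rewrite hroot2nK.
Qed.

End Eta.

(* Main.v *)
(* Write a, e for alpha, eta and, here and in the lemmas on the tower, y for the
   monomial y^-1, so that a^2 = a + y and e^2 = e + y a.
   As elements of K have no finite limits, v(a + c) < 0 for all c in K; together
   with Frobenius this is all that is used of the series a and e.
   A generator of M is theta = u + w e with u, w in L = K + K a and w <> 0. Iterated
   square roots of the equations of a and e give e_n in L with
   v(e - e_n) = v(e) / 2^n, and for large n the element u + w e_n of L is closer to
   theta than every element of K. Hence d_1 = 2 for every generator theta, and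
   depth theta >= 2 as theta has degree at least 3. For theta = e, of degree 4, one
   has d_2 = 4: a cubic element b with v(e - b) > v(a) would have its mean conjugate,
   an element of K, at distance at least v(a) from e, while v(e - c) < v(a) for all
   c in K. *)

From HB Require Import structures.
Require Import Defs.
From mathcomp Require Import all_boot all_order all_algebra ring lra.
From mathcomp Require Import boolp classical_sets fsbigop constructive_ereal.
From mathcomp Require Import reals topology normedtype.

Set Implicit Arguments.
Unset Strict Implicit.
Unset Printing Implicit Defensive.

Import Order.TTheory GRing.Theory Num.Theory.
Import numFieldNormedType.Exports.
Local Open Scope ring_scope.

(** * The valuation of the Hahn field *)

Section HahnValuation.
Variable k : fieldType.
Implicit Types (s t : {hahn k}) (x : \bar rat) (m : rat).

Lemma hval0 : hval (0 : {hahn k}) = +oo%E.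
Proof. by rewrite /hval eqxx. Qed.

Lemma hval_eq s m :
  s m != 0 -> (forall q, s q != 0 -> m <= q) -> hval s = m%:E.
Proof.
move=> sm mP; rewrite /hval; case: eqP => [s0|_]; first by rewrite s0 eqxx in sm.
congr _%:E; apply: xget_subset1 => // m1 m2 [s1 P1] [s2 P2].
by apply/le_anti; rewrite P1 ?P2.
Qed.

Lemma hval_fin s : s != 0 ->
  exists m, [/\ hval s = m%:E, s m != 0 & forall q, s q != 0 -> m <= q].
Proof. by move=> /hmin[m sm mP]; exists m; split=> //; apply: hval_eq. Qed.

(** Vanishing of the coefficients below m passes to sums term by term, so this form of a lower bound
    yields the ultrametric inequality. *)
Lemma hval_geP s m : (m%:E <= hval s)%E <-> (forall q, q < m -> s q = 0).
Proof.
have [->|/hval_fin[n [-> sn nP]]] := eqVneq s 0; first by rewrite hval0 leey.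
rewrite lee_fin; split=> [mn q qm|P].
  by apply: contraTeq qm => /nP nq; rewrite -leNgt (le_trans mn).
by rewrite leNgt; apply/negP => /P e; rewrite e eqxx in sn.
Qed.

Lemma hval_eqy s : (hval s == +oo%E) = (s == 0).
Proof.
by have [->|/hval_fin[n [-> _ _]]] := eqVneq s 0; [rewrite hval0 eqxx|].
Qed.

Lemma hvalM s t : hval (s * t) = (hval s + hval t)%E.
Proof.
have [->|/hval_fin[m [-> sm mP]]] := eqVneq s 0.
  rewrite mul0r hval0 addye//.
  by have [->|/hval_fin[n [-> _ _]]] := eqVneq t 0; rewrite ?hval0.
have [->|/hval_fin[n [-> tn nP]]] := eqVneq t 0; first by rewrite mulr0 hval0.
apply: hval_eq => [|q /hcoefM_neq0[a [b [/mP ma /nP nb ->]]]]; last exact: lerD.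
(* Only the pair (m, n) of exponents from the two supports adds up to m + n, so the leading
   coefficients multiply. *)
rewrite [_ (m + n)](@hmul_seq _ [:: m])//.
  by rewrite big_seq1 addrAC subrr add0r mulf_neq0.
by move=> a /mP ma /nP na; rewrite inE; apply/eqP; lra.
Qed.

Lemma hval1 : hval (1 : {hahn k}) = 0%E.
Proof.
apply: hval_eq => [|q]; rewrite hcoef1 ?eqxx ?oner_neq0//.
by have [->//|] := eqVneq q 0; rewrite eqxx.
Qed.

Lemma hvalN s : hval (- s) = hval s.
Proof.
have [->|/hval_fin[m [-> sm mP]]] := eqVneq s 0; first by rewrite oppr0.
by apply: hval_eq => [|q]; rewrite hcoefN oppr_eq0//; apply: mP.
Qed.

Lemma hval_mono m : hval (hmono 1 m : {hahn k}) = m%:E.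
Proof.
apply: hval_eq => [|q] /=; first by rewrite eqxx oner_neq0.
by have [->//|] := eqVneq q m; rewrite eqxx.
Qed.

Lemma hvalX s n m : hval s = m%:E -> hval (s ^+ n) = (m *+ n)%:E.
Proof.
move=> sm; elim: n => [|n IH]; first by rewrite expr0 hval1.
by rewrite exprS hvalM IH sm mulrS.
Qed.

Lemma hval_geD x s t : (x <= hval s -> x <= hval t -> x <= hval (s + t)%R)%E.
Proof.
case: x => [m||_ _]; last exact: leNye.
  move=> /hval_geP sP /hval_geP tP; apply/hval_geP => q qm.
  by rewrite hcoefD sP// tP// addr0.
by rewrite !leye_eq !hval_eqy => /eqP-> /eqP->; rewrite addr0.
Qed.

Lemma hval_gtD x s t : (x < hval s -> x < hval t -> x < hval (s + t)%R)%E.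
Proof.
move=> xs xt; have [st|ts] := leP (hval s) (hval t).
  exact: lt_le_trans xs (hval_geD _ _).
by apply: lt_le_trans xt (hval_geD (ltW ts) _).
Qed.

Lemma hval_geB x s t : (x <= hval s -> x <= hval t -> x <= hval (s - t)%R)%E.
Proof. by move=> xs xt; apply: hval_geD; rewrite ?hvalN. Qed.

Lemma hvalDl s t : (hval s < hval t)%E -> hval (s + t) = hval s.
Proof.
move=> st; apply/eqP; rewrite eq_le [X in _ && X]hval_geD ?(ltW st)// andbT.
rewrite leNgt; apply/negP => lt; have := hval_gtD lt (t := - t).
by rewrite hvalN addrK ltxx => /(_ st).
Qed.

Lemma hvalV s m : hval s = m%:E -> hval s^-1 = (- m)%:E.
Proof.
move=> sm; have s0 : s != 0 by rewrite -hval_eqy sm.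
have [n [sn _ _]] : exists n, [/\ hval s^-1 = n%:E, s^-1 n != 0 &
    forall q, s^-1 q != 0 -> n <= q] by apply: hval_fin; rewrite invr_eq0.
have : hval (s * s^-1) = 0%E by rewrite divff// hval1.
rewrite hvalM sm sn => /(congr1 fine) /= /eqP.
by rewrite addrC addr_eq0 => /eqP->.
Qed.

End HahnValuation.

Lemma archi_div2X (R : archiRealFieldType) (c d : R) :
  0 < d -> exists n : nat, c / 2 ^+ n < d.
Proof.
move=> d0; exists (Num.bound (c / d)); set n := Num.bound _.
rewrite ltr_pdivrMr ?exprn_gt0// mulrC -ltr_pdivrMr//.
apply: le_lt_trans (ler_norm _) (lt_trans (archi_boundP (normr_ge0 _)) _).
rewrite -/n; have -> : Num.bound `|c / d| = n by rewrite /n /Num.bound normr_id.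
by rewrite -natrX ltr_nat ltn_expl.
Qed.

(** * The distance from alpha to K *)

Section AlphaDistance.
Variable k : fieldType.

Lemma alpha_coef n : alpha k (- (2 ^- n.+1)) = 1.
Proof.
have [_ _ ->] := alpha_is_hsum k.
rewrite (fsbigE [:: n])//.
  by rewrite big_cons big_nil in_setT /= eqxx addr0.
move=> m _; rewrite inE => nm /=; case: eqP => // e.
by rewrite (@dyadic_inj n m e) eqxx in nm.
Qed.

(** Otherwise c would have coefficient -1 at every exponent -1/2^(n+1), and 0 would be an
    accumulation point of its support. *)
Lemma hval_alphaD_lt0 (R : realType) (K : {pred {hahn k}}) c :
  no_finite_limits R K -> c \in K -> (hval (alpha k + c)%R < 0)%E.
Proof.
move=> nfl cK; rewrite ltNge; apply/negP => /hval_geP a_c.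
suff: limit_point ((@ratr R) @` hsupp c)%classic 0 by rewrite nfl.
move=> U [e /= e0 eU].
have [n] := archi_div2X 1 e0; rewrite mul1r => ne.
have q0 : 2 ^- n.+1 > 0 :> rat by rewrite invr_gt0 exprn_gt0.
exists (ratr (- (2 ^- n.+1))); split.
- by rewrite fmorph_eq0 oppr_eq0 gt_eqF.
- exists (- (2 ^- n.+1)) => //; rewrite /hsupp /=.
  have := a_c _ (_ : - (2 ^- n.+1) < 0); rewrite oppr_lt0 => /(_ q0).
  rewrite hcoefD alpha_coef => /eqP; rewrite addrC addr_eq0 => /eqP->.
  by rewrite oppr_eq0 oner_neq0.
- apply: eU; rewrite /ball_ /= sub0r rmorphN opprK fmorphV rmorphXn /= ratr_nat.
  rewrite ger0_norm ?invr_ge0 ?exprn_ge0//; apply: le_lt_trans ne.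
  by rewrite lef_pV2 ?posrE ?exprn_gt0// ler_eXn2l ?ltr1n.
Qed.

End AlphaDistance.

(** * Degrees and quadratic extensions of a subfield *)

Section Subextensions.
Variable F : fieldType.
Implicit Types (x y p q : F).

Lemma least_eq (P : set nat) m : P m -> (forall n, P n -> (m <= n)%N) ->
  least P = m.
Proof.
move=> Pm mP; apply: xget_subset1 => // n1 n2 [P1 m1] [P2 m2].
by apply/eqP; rewrite eqn_leq m1 ?m2.
Qed.

Lemma leastP (P : set nat) n : P n ->
  P (least P) /\ (forall m, P m -> (least P <= m)%N).
Proof.
move=> Pn; have ex : exists m, `[< P m >] by exists n; apply/asboolP.
case: (ex_minnP ex) => m /asboolP Pm mP.
by rewrite (least_eq Pm) => [|j Pj]; last exact/mP/asboolP; split=> // j /asboolP/mP.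
Qed.

Lemma least_gt0P (P : set nat) : (0 < least P)%N ->
  P (least P) /\ (forall m, P m -> (least P <= m)%N).
Proof.
move=> P0; suff [n Pn] : exists n, P n by apply: leastP Pn.
apply: contrapT => /forallNP nP; move: P0; rewrite /least xgetPN// => m [Pm _].
exact: nP Pm.
Qed.

Lemma sub_adjoin (K : {pred F}) x : {subset K <= adjoin K x}.
Proof. by move=> z zK; apply/asboolP => E; apply; left. Qed.

Lemma mem_adjoin (K : {pred F}) x : x \in adjoin K x.
Proof. by apply/asboolP => E; apply; right. Qed.

Lemma adjoin_sub (K : {pred F}) (E : divringClosed F) x :
  {subset K <= E} -> x \in E -> {subset adjoin K x <= E}.
Proof. by move=> KE xE z /asboolP; apply=> t [/KE//|->]. Qed.

Section OverK.
Variable K : divringClosed F.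

(** [least] returns 0 on the empty set, so a positive degree already supplies an annihilating
    polynomial; scaling makes it monic. *)
Lemma degree_over_gt0P x : (0 < degree_over K x)%N -> exists f,
  [/\ f \is a polyOver K, f \is monic, size f = (degree_over K x).+1 & root f x].
Proof.
move=> /least_gt0P[[f [fK f0 fs fx]] _]; exists ((lead_coef f)^-1 *: f).
have l0 : (lead_coef f)^-1 != 0 by rewrite invr_eq0 lead_coef_eq0.
split.
- by apply: polyOverZ => //; rewrite rpredV; apply: (polyOverP fK).
- by rewrite monicE lead_coefZ mulVf// lead_coef_eq0.
- by rewrite size_scale.
- by rewrite rootZ.
Qed.

Lemma degree_over_le x f : f \is a polyOver K -> f != 0 -> root f x ->
  (degree_over K x <= (size f).-1)%N.
Proof.
move=> fK f0 fx; apply: (leastP (n := (size f).-1) _).2.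
all: by exists f; split; rewrite // prednK ?size_poly_gt0.
Qed.

Lemma degree_over_gt0 x : algebraic_over K x -> (0 < degree_over K x)%N.
Proof.
move=> [f [fK f0 fx]].
have [|[g [gK g0 gs gx]] _] := @leastP [set n | exists f,
    [/\ f \is a polyOver K, f != 0, size f = n.+1 & root f x]] (size f).-1.
  by exists f; split; rewrite // prednK ?size_poly_gt0.
rewrite lt0n; apply: contraTneq gx => /eqP; rewrite /degree_over => /eqP d0.
have /size_poly1P[c c0 ->] : size g == 1 by rewrite gs d0.
by rewrite rootC.
Qed.

(** With the coefficients listed from the constant term up, [horner_rec] unfolds to an expression
    accessible to [ring]; the nonzero last entry fixes the degree. *)
Lemma degree_over_seq x (s : seq F) : all [in K] s -> last 0 s != 0 ->
  horner_rec s x = 0 -> algebraic_over K x /\ (degree_over K x <= (size s).-1)%N.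
Proof.
move=> /allP sK s0 sx.
have fE : Poly s = s :> seq F.
  exact: (@PolyK _ 0).
have fK : Poly s \is a polyOver K.
  apply/polyOverP => i; rewrite coef_Poly.
  have [is_|si] := ltnP i (size s); last by rewrite nth_default// rpred0.
  exact/sK/mem_nth.
have f0 : Poly s != 0.
  by rewrite -size_poly_gt0 fE; case: (s) s0; rewrite //= eqxx.
have fx : root (Poly s) x by rewrite /root horner_Poly sx.
by split; [exists (Poly s)|rewrite -fE; apply: degree_over_le].
Qed.

Lemma degree_over_in x : x \in K -> degree_over K x = 1%N.
Proof.
move=> xK; have [|||xa le1] := @degree_over_seq x [:: - x; 1].
- by rewrite /= rpredN xK rpred1.
- exact: oner_neq0.
- by rewrite /= mul0r add0r mul1r subrr.
by apply/eqP; rewrite eqn_leq le1 degree_over_gt0.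
Qed.

Lemma degree_over_eq1 x : degree_over K x = 1%N -> x \in K.
Proof.
move=> d1; have := @degree_over_gt0P x; rewrite d1 => /(_ isT)[f [/polyOverP fK fm fs]].
have f1 : f`_1 = 1 by move/monicP: fm; rewrite lead_coefE fs.
rewrite /root horner_coef fs big_ord_recr big_ord1 /= expr0 expr1 f1 mulr1 mul1r addrC.
by rewrite addr_eq0 => /eqP->; rewrite rpredN.
Qed.

Lemma degree_over_gt1 x : algebraic_over K x -> x \notin K ->
  (1 < degree_over K x)%N.
Proof.
move=> /degree_over_gt0 d0 xK; rewrite ltn_neqAle d0 andbT eq_sym.
by apply: contra xK => /eqP/degree_over_eq1.
Qed.

Lemma quadratic_degree x p q : x \notin K -> p \in K -> q \in K ->
  x ^+ 2 + p * x + q = 0 -> algebraic_over K x /\ degree_over K x = 2%N.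
Proof.
move=> xK pK qK xE; have [|||xa le2] := @degree_over_seq x [:: q; p; 1].
- by rewrite /= pK qK rpred1.
- exact: oner_neq0.
- by apply: etrans xE => /=; ring.
by split=> //; apply/eqP; rewrite eqn_leq le2 degree_over_gt1.
Qed.

Lemma degree_over_eq2 x : degree_over K x = 2%N ->
  exists p q, [/\ p \in K, q \in K & x ^+ 2 + p * x + q = 0].
Proof.
move=> d2; have := @degree_over_gt0P x; rewrite d2 => /(_ isT)[f [/polyOverP fK fm fs]].
have f2 : f`_2 = 1 by move/monicP: fm; rewrite lead_coefE fs.
rewrite /root horner_coef fs !big_ord_recr big_ord0 /= f2 => /eqP xE.
by exists f`_1, f`_0; split=> //; apply: etrans xE; ring.
Qed.

Lemma degree_over_eq3 x : degree_over K x = 3%N ->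
  exists p q r, [/\ p \in K, q \in K, r \in K,
    x ^+ 3 + p * x ^+ 2 + q * x + r = 0 &
    forall z, z \in K -> z ^+ 3 + p * z ^+ 2 + q * z + r != 0].
Proof.
move=> d3; have := @degree_over_gt0P x; rewrite d3 => /(_ isT)[f [/polyOverP fK fm fs]].
have f3 : f`_3 = 1 by move/monicP: fm; rewrite lead_coefE fs.
rewrite /root horner_coef fs !big_ord_recr big_ord0 /= f3 => /eqP xE.
have {}xE : x ^+ 3 + f`_2 * x ^+ 2 + f`_1 * x + f`_0 = 0 by apply: etrans xE; ring.
exists f`_2, f`_1, f`_0; split=> // z zK; apply/eqP => zE.
have xz : x - z != 0.
  by rewrite subr_eq0; apply: contra_eqN d3 => /eqP->; rewrite degree_over_in.
(* The quotient of the cubic by X - z annihilates x, against degree 3. *)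
have [|||_] := @degree_over_seq x
    [:: z ^+ 2 + f`_2 * z + f`_1; z + f`_2; 1]; last by rewrite d3.
- by rewrite /= !(rpredD, rpredM, rpredX, rpred1).
- exact: oner_neq0.
apply: (mulfI xz); apply: etrans (etrans (congr2 (fun u v => u - v) xE zE) _).
  by rewrite /=; ring.
by rewrite subr0 mulr0.
Qed.

(** The equation of x closes K + K x under products, and conjugate over norm gives inverses; being a
    field, it contains K(x) by minimality. *)
Lemma adjoin_quadratic x p q : p \in K -> q \in K -> x \notin K ->
  x ^+ 2 + p * x + q = 0 ->
  forall z, z \in adjoin K x <-> exists a b, [/\ a \in K, b \in K & z = a + b * x].
Proof.
move=> pK qK xK xE z; split; last first.
  move=> [a [b [aK bK ->]]]; apply/asboolP => E SE.
  by rewrite rpredD ?rpredM//; apply: SE; [left|left|right].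
pose P : {pred F} := fun z => `[< exists a b, [/\ a \in K, b \in K & z = a + b * x] >].
have PE u : reflect (exists a b, [/\ a \in K, b \in K & u = a + b * x]) (u \in P).
  exact: asboolP.
have Pdiv : divring_closed P.
  have xx : x ^+ 2 = - (p * x) - q by apply/eqP; rewrite -subr_eq0 -xE; apply/eqP; ring.
  have PM u v : u \in P -> v \in P -> u * v \in P.
    move=> /PE[a [b [aK bK ->]]] /PE[c [d [cK dK ->]]]; apply/PE.
    exists (a * c - b * d * q), (a * d + b * c - b * d * p).
    rewrite !(rpredB, rpredD, rpredM)//; split=> //.
    have -> : (a + b * x) * (c + d * x) = a * c + (a * d + b * c) * x + b * d * x ^+ 2.
      by ring.
    by rewrite xx; ring.
  split=> [|_ _ /PE[a [b [aK bK ->]]] /PE[c [d [cK dK ->]]]|u v uP].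
  - by apply/PE; exists 1, 0; rewrite rpred1 rpred0 mul0r addr0.
  - by apply/PE; exists (a - c), (b - d); rewrite !rpredB//; split=> //; ring.
  move=> /PE[a [b [aK bK ->]]]; apply: PM => //; apply/PE.
  (* The norm of a + b x: as x has trace -p, the conjugate is a - b p - b x. *)
  pose N := a ^+ 2 - p * a * b + q * b ^+ 2.
  have NE : (a + b * x) * (a - b * p - b * x) = N.
    have -> : (a + b * x) * (a - b * p - b * x)
        = a ^+ 2 - p * a * b - b ^+ 2 * (p * x) - b ^+ 2 * x ^+ 2 by ring.
    by rewrite xx /N; ring.
  have [b0|b0] := eqVneq b 0.
    by exists a^-1, 0; rewrite rpredV rpred0 b0 !mul0r !addr0.
  have notK c : c \in K -> c + b * x != 0.
    move=> cK; apply: contra xK; rewrite addrC addr_eq0 => /eqP bx.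
    have -> : x = - c / b by rewrite -bx mulrC mulKf.
    by rewrite rpred_div ?rpredN.
  have N0 : N != 0.
    rewrite -NE mulf_neq0 ?notK// -oppr_eq0.
    have -> : - (a - b * p - b * x) = (b * p - a) + b * x by ring.
    by rewrite notK ?rpredB ?rpredM.
  have NK : N \in K by rewrite /N rpredD ?rpredB ?rpredM ?rpredX.
  exists ((a - b * p) / N), (- b / N).
  rewrite !rpred_div ?rpredN ?rpredB ?rpredM//; split=> //.
  apply: (mulfI (notK _ aK)); rewrite divff ?notK//.
  have -> : (a + b * x) * ((a - b * p) / N + - b / N * x)
      = (a + b * x) * (a - b * p - b * x) / N by ring.
  by rewrite NE divff.
pose Pc := HB.pack_for (divringClosed F) P (GRing.isDivringClosed.Build F P Pdiv).
move=> /asboolP /(_ Pc) zP; apply/PE; apply: zP => u [uK|->].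
- by apply/PE; exists u, 0; rewrite rpred0 mul0r addr0.
- by apply/PE; exists 0, 1; rewrite rpred0 rpred1 mul1r add0r.
Qed.

End OverK.
End Subextensions.

(** * Cubics over a Henselian field *)

Section Cubic.
Variables (k : fieldType) (K : divringClosed {hahn k}).
Hypothesis hK : henselian K.
Implicit Types (p q r s x y z : {hahn k}).

(** The leading coefficient is left free because the lemma serves cubics whose reduction has lower
    degree. *)
Lemma henselian_cubic (c0 c1 c2 c3 a : {hahn k}) :
  [/\ c0 \in K, c1 \in K, c2 \in K, c3 \in K & a \in K] ->
  [/\ (0 <= hval c0)%E, (0 <= hval c1)%E, (0 <= hval c2)%E, (0 <= hval c3)%E
    & (0 <= hval a)%E] ->
  (0 < hval (c3 * a ^+ 3 + c2 * a ^+ 2 + c1 * a + c0)%R)%E ->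
  hval (c3 * a ^+ 2 * 3 + c2 * a * 2 + c1) = 0%E ->
  exists2 b, b \in K & c3 * b ^+ 3 + c2 * b ^+ 2 + c1 * b + c0 = 0.
Proof.
move=> [K0 K1 K2 K3 aK] [v0 v1 v2 v3 va] fa f'a.
pose f := c3 *: 'X^3 + c2 *: 'X^2 + c1 *: 'X + c0%:P.
have fE b : f.[b] = c3 * b ^+ 3 + c2 * b ^+ 2 + c1 * b + c0 by rewrite !hornerE.
have f'E : f^`().[a] = c3 * a ^+ 2 * 3 + c2 * a * 2 + c1.
  rewrite /f !derivE !hornerE /=; ring.
have [||||b [[bK _] fb _]] := hK (f := f) (a := a); rewrite ?fE ?f'E//.
- move=> i; rewrite /f !coefE; case: i => [|[|[|[|i]]]] /=; split.
  all: rewrite ?(mulr0, mulr1, addr0, add0r) ?rpred0 ?hval0//.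
by exists b => //; rewrite -fE; apply/eqP.
Qed.

Lemma hval_div_ge0 x y : (hval x <= hval y)%E -> x != 0 -> (0 <= hval (y / x)%R)%E.
Proof.
move=> xy x0; have [n [xn _ _]] := hval_fin x0.
by rewrite hvalM (hvalV xn) EFinN sube_ge0 ?xn// -xn.
Qed.

Lemma hval_div_gt0 x y : (hval x < hval y)%E -> x != 0 -> (0 < hval (y / x)%R)%E.
Proof.
move=> xy x0; have [n [xn _ _]] := hval_fin x0.
by rewrite hvalM (hvalV xn) EFinN sube_gt0 -?xn.
Qed.

Lemma hvalM_gt0 x y : (0 < hval x)%E -> (0 <= hval y)%E -> (0 < hval (x * y)%R)%E.
Proof. by move=> x0 y0; rewrite hvalM addeC; apply: lte_spaddre x0 y0. Qed.

Lemma hval_natr_ge0 n : (0 <= hval (n%:R : {hahn k}))%E.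
Proof.
elim: n => [|n IH]; first by rewrite hval0 leey.
by rewrite -natr1; apply: hval_geD; rewrite ?hval1.
Qed.

(* If v(p) < 0, divide by whichever of p, q has the least value: the reduction of
   the cubic is then linear, or that of its reciprocal has 0 as a simple root. *)
Lemma hval_cubic_coef p q r x : p \in K -> q \in K -> r \in K ->
  hval x = 0%E -> x ^+ 3 + p * x ^+ 2 + q * x + r = 0 ->
  (forall z, z \in K -> z ^+ 3 + p * z ^+ 2 + q * z + r != 0) ->
  (0 <= hval p)%E.
Proof.
move=> pK qK rK x0 xE noroot; rewrite leNgt; apply/negP => p0.
have xX n : hval (x ^+ n) = 0%E by rewrite (hvalX _ x0) mul0rn.
(* As v(x) = 0, the equation expresses r through terms of value at least v(s). *)
have r_ge (s : {hahn k}) : (hval s < 0)%E -> (hval s <= hval p)%E ->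
    (hval s <= hval q)%E -> (hval s <= hval r)%E.
  move=> s0 sp sq; have -> : r = - (x ^+ 3 + p * x ^+ 2 + q * x).
    by apply/eqP; rewrite -subr_eq0 opprK -xE; apply/eqP; ring.
  rewrite hvalN; apply: hval_geD; [apply: hval_geD|].
  - by rewrite xX ltW.
  - by rewrite hvalM xX adde0.
  - by rewrite hvalM x0 adde0.
have neq0 (s : {hahn k}) : (hval s < 0)%E -> s != 0.
  by apply: contraTneq => ->; rewrite hval0.
have [qp|pq] := ltP (hval q) (hval p).
- have q0 := lt_trans qp p0; have qn0 := neq0 _ q0.
  have rq := r_ge _ q0 (ltW qp) (lexx _).
  have q1 : (0 < hval (q^-1)%R)%E.
    by rewrite -[q^-1]mul1r hval_div_gt0// hval1.
  have pq1 := hval_div_gt0 qp qn0; have rq0 := hval_div_ge0 rq qn0.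
  have rqX n : (0 <= hval ((- (r / q)) ^+ n)%R)%E.
    by elim: n => [|n IH]; rewrite ?expr0 ?hval1// exprS hvalM adde_ge0 ?hvalN.
  (* The cubic divided by q reduces to X + r/q, whence the approximate root. *)
  have [||||b bK bE] := @henselian_cubic (r / q) 1 (p / q) q^-1 (- (r / q)).
  + by split; rewrite ?rpredN ?rpred1 ?rpred_div ?rpredV.
  + by split; rewrite ?hvalN ?hval1 ?(ltW q1) ?(ltW pq1).
  + by rewrite mul1r subrK; apply: hval_gtD; apply: hvalM_gt0.
  + rewrite addrC hvalDl hval1//; apply: hval_gtD; rewrite -mulrA.
      by apply: hvalM_gt0 => //; rewrite hvalM adde_ge0// hval_natr_ge0.
    apply: hvalM_gt0 => //; rewrite hvalM adde_ge0 ?hval_natr_ge0//.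
    exact: (rqX 1%N).
  + move/eqP: (noroot _ bK); apply; apply: (mulfI (invr_neq0 qn0)).
    by rewrite mulr0 -bE; field.
- have pn0 := neq0 _ p0.
  have rp := r_ge _ p0 (lexx _) pq.
  have p1 : (0 < hval (p^-1)%R)%E by rewrite -[p^-1]mul1r hval_div_gt0// hval1.
  (* The reciprocal cubic divided by p. Its constant term 1/p forces b to be nonzero, and b^-1 is a
     root of the original cubic. *)
  have [||||b bK bE] := @henselian_cubic p^-1 1 (q / p) (r / p) 0.
  + by split; rewrite ?rpred0 ?rpred1 ?rpred_div ?rpredV.
  + by split; rewrite ?hval0 ?hval1 ?leey ?(ltW p1) ?hval_div_ge0.
  + by rewrite !expr0n !mulr0 !add0r.
  + by rewrite expr0n !mulr0 !mul0r !add0r hval1.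
  have b0 : b != 0.
    apply: contra_eq_neq bE => ->; rewrite !expr0n !mulr0 !add0r.
    exact: invr_neq0.
  move/eqP: (noroot _ (rpredVr bK)); apply.
  apply: (mulfI (mulf_neq0 (expf_neq0 3 b0) (invr_neq0 pn0))); rewrite mulr0 -bE.
  by field; rewrite pn0 b0.
Qed.

End Cubic.

(** * General bounds on the sequence d_l and on the depth *)

Section Depth.
Variables (k : fieldType) (K : divringClosed {hahn k}).
Implicit Types theta : {hahn k}.

(** The degree of theta is itself a candidate: b = theta gives the value +oo, which elements of
    degree d cannot attain. *)
Lemma next_d_bounds theta d : algebraic_over K theta ->
  (d < degree_over K theta)%N ->
  (d < next_d K theta d <= degree_over K theta)%N.
Proof.
move=> ta dn; set N := degree_over K theta in dn *.
have PN : [set m | (d < m)%N /\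
   exists2 e, Dset K theta m e & forall x, Dset K theta d x -> (x < e)%E]%classic N.
  split=> //; exists +oo%E; first by exists theta; rewrite ?subrr ?hval0.
  move=> _ [b [_ bd] <-]; rewrite ltey hval_eqy subr_eq0.
  by apply: contraTneq dn => tb; rewrite /N tb bd ltnn.
by have [[lt _] le] := leastP PN; rewrite /next_d lt le.
Qed.

(** The iterates increase strictly until they reach the degree, so [depth] is not the default value
    of [least]; lengths 0 and 1 would give degrees 1 and 2. *)
Lemma depth_gt1 theta : algebraic_over K theta -> next_d K theta 1 = 2%N ->
  (2 < degree_over K theta)%N -> (1 < depth K theta)%N.
Proof.
move=> ta nd n2; have reach (d : nat) : (d <= degree_over K theta)%N ->
    exists r, iter r (next_d K theta) d = degree_over K theta.
  move=> /subnKC; move: (_ - d)%N => j; elim/ltn_ind: j d => j IH d jd.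
  have [j0|j0] := posnP j; first by exists 0%N; rewrite -jd j0 addn0.
  have dN : (d < degree_over K theta)%N by rewrite -jd -[ltnLHS]addn0 ltn_add2l.
  have /andP[ltd led] := next_d_bounds ta dN.
  have [|r rE] := IH (degree_over K theta - next_d K theta d)%N _ _ (subnKC led).
    by rewrite -(addKn d j) jd ltn_sub2l.
  by exists r.+1; rewrite iterSr.
have [r rP] := reach 1%N (ltnW (ltnW n2)).
have [] := @leastP
  [set r | iter r (next_d K theta) 1%N = degree_over K theta]%classic r rP.
rewrite /= -/(depth K theta) => + _.
by case: (depth K theta) => [|[|]]//=; rewrite ?nd => E; rewrite -E in n2.
Qed.

End Depth.

(** * Characteristic 2 and iterated roots of the generators of the tower *)

Section ArtinSchreierTower.
Variables (k : fieldType) (K : divringClosed {hahn k}) (y a e : {hahn k}).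
Hypothesis k2 : 2%N \in [pchar k].
Hypothesis yK : y \in K.
Hypothesis vy : hval y = (- 1)%:E.
Hypothesis sqrtK : forall x, x \in K -> exists2 z, z \in K & z ^+ 2 = x.
Hypothesis aE : a ^+ 2 = a + y.
Hypothesis eE : e ^+ 2 = e + y * a.
Hypothesis aK_lt0 : forall c, c \in K -> (hval (a + c)%R < 0)%E.
Implicit Types (c d p q r s w x z : {hahn k}).

Let two0 : 2%:R = 0 :> {hahn k}.
Proof. exact: pcharf0 (hpchar2 k2). Qed.

(** Lets [ring] prove identities of characteristic 2: w is half the difference of the two sides as
    integral expressions. *)
Lemma eq_mod2 x z w : x = z + 2%:R * w -> x = z.
Proof. by rewrite two0 mul0r addr0. Qed.

Lemma hsqrD x z : (x + z) ^+ 2 = x ^+ 2 + z ^+ 2.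
Proof. by apply: (@eq_mod2 _ _ (x * z)); ring. Qed.

Lemma hoppr x : - x = x.
Proof. exact: oppr_pchar2 (hpchar2 k2) x. Qed.

(** If z^2 = y + s, then (a + z)^2 = a + s, so each square root taken in K moves one step
    further. *)
Lemma alpha_root n : exists2 s, s \in K & (a + s) ^+ (2 ^ n) = a.
Proof.
elim: n => [|n [s sK sE]]; first by exists 0; rewrite ?rpred0// addr0 expr1.
have [z zK zE] := sqrtK (rpredD yK sK); exists z => //.
rewrite expnS exprM hsqrD zE aE -[RHS]sE; congr (_ ^+ _).
by apply: (@eq_mod2 _ _ y); ring.
Qed.

(* The 2^n-th root of e is the n-th tail of the series of e; the truncation it
   leaves is linear in a, with the n-th truncation of a as its slope. *)
Lemma eta_root n : exists s r, [/\ s \in K, r \in K,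
  (a + s) ^+ (2 ^ n) = a & (e + (s * a + r)) ^+ (2 ^ n) = e].
Proof.
elim: n => [|n [s [r [sK rK sE rE]]]].
  by exists 0, 0; rewrite rpred0 mul0r !addr0 !expr1.
have [z zK zE] := sqrtK (rpredD yK sK).
(* The term (y + s) y cancels the one arising from (z a)^2 = (y + s) (a + y). *)
have [w wK wE] : exists2 w, w \in K & w ^+ 2 = r + (y + s) * y.
  by apply: sqrtK; rewrite rpredD ?rpredM ?rpredD.
exists z, w; split=> //; rewrite expnS exprM.
  rewrite hsqrD zE aE -[RHS]sE; congr (_ ^+ _).
  by apply: (@eq_mod2 _ _ y); ring.
rewrite !hsqrD wE exprMn zE aE eE -[RHS]rE; congr (_ ^+ _).
by apply: (@eq_mod2 _ _ (y * a + (y + s) * y)); ring.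
Qed.

Lemma hval_root n x z (m : rat) : x ^+ (2 ^ n) = z -> hval z = m%:E ->
  hval x = (m / 2 ^+ n)%:E.
Proof.
move=> xz zm; have x0 : x != 0.
  apply: contra_eqN zm => /eqP x0; rewrite -xz x0 expr0n expn_eq0 /=.
  by rewrite hval0.
have [h [xh _ _]] := hval_fin x0.
have := hvalX (2 ^ n) xh; rewrite xz zm => /(congr1 fine) /= ->.
by rewrite xh -[h *+ _]mulr_natr natrX mulfK// expf_neq0.
Qed.

Lemma hval_sqrD x (m : rat) : hval x = m%:E -> m < 0 -> hval (x ^+ 2 + x) = (m *+ 2)%:E.
Proof.
move=> xm m0; have x2 := hvalX 2 xm; rewrite hvalDl// x2 xm lte_fin mulr2n; lra.
Qed.

Lemma hval_a : hval a = (- (1 / 2))%:E.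
Proof.
have := aK_lt0 (rpred0 _); rewrite addr0 => a0.
have [|m [am _ _]] := @hval_fin _ a.
  by apply: contraTneq a0 => ->; rewrite hval0.
move: a0; rewrite am lte_fin => m0; have := hval_sqrD am m0.
have -> : a ^+ 2 + a = y by rewrite aE; apply: (@eq_mod2 _ _ a); ring.
by rewrite vy => /(congr1 fine) /= e1; congr _%:E; lra.
Qed.

Lemma hval_e : hval e = (- (3 / 4))%:E.
Proof.
have yaE : e ^+ 2 + e = y * a by rewrite eE; apply: (@eq_mod2 _ _ e); ring.
have vya : hval (y * a) = (- (3 / 2))%:E.
  by rewrite hvalM vy hval_a -EFinD; congr _%:E; lra.
have e0 : (hval e < 0)%E.
  rewrite ltNge; apply/negP => e0; have : (0 <= hval (e ^+ 2 + e)%R)%E.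
    by apply: hval_geD => //; rewrite expr2 hvalM adde_ge0.
  by rewrite yaE vya lee_fin; lra.
have [|m [em _ _]] := @hval_fin _ e.
  by apply: contraTneq e0 => ->; rewrite hval0.
move: e0; rewrite em lte_fin => m0; have := hval_sqrD em m0.
by rewrite yaE vya => /(congr1 fine) /= e1; congr _%:E; lra.
Qed.

(** * Distances in the tower and approximation by K + K a *)

Lemma a_notin c : c \in K -> a + c != 0.
Proof. by move=> /aK_lt0; apply: contraTneq => ->; rewrite hval0. Qed.

(** After division by q this is v(a + p/q) < 0. *)
Lemma hval_linear_lt p q : p \in K -> q \in K -> q != 0 ->
  (hval (p + q * a)%R < hval q)%E.
Proof.
move=> pK qK q0; have [m [qm _ _]] := hval_fin q0.
have -> : p + q * a = q * (a + p / q) by field.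
have := aK_lt0 (rpred_div pK qK); rewrite hvalM qm.
by rewrite -[X in (_ -> (_ < X)%E)]adde0 lteD2lE.
Qed.

(* Frobenius: z = e + d a + c satisfies z^2 + z in E a + K with
   E = (a + d)^2 + (a + d) in K, and v(E) = 2 v(a + d). *)
Lemma hval_eta_lt c d : c \in K -> d \in K ->
  (hval (e + d * a + c)%R < hval (a + d)%R)%E.
Proof.
move=> cK dK; set z := e + d * a + c; rewrite ltNge; apply/negP => ad_z.
have ad0 := aK_lt0 dK.
have [m [adm _ _]] := hval_fin (a_notin dK).
move: ad0 ad_z; rewrite adm lte_fin => m0 ad_z.
pose E := y + d ^+ 2 + d.
have EE : E = (a + d) ^+ 2 + (a + d).
  rewrite hsqrD aE; apply/esym; apply: (@eq_mod2 _ _ a); rewrite /E; ring.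
have EK : E \in K by rewrite !rpredD ?rpredX.
have vE : hval E = (m *+ 2)%:E by rewrite EE (hval_sqrD adm).
have E0 : E != 0 by rewrite -hval_eqy vE.
have zE : z ^+ 2 + z = d ^+ 2 * y + c ^+ 2 + c + E * a.
  rewrite /z !hsqrD exprMn aE eE; apply: (@eq_mod2 _ _ e); rewrite /E; ring.
(* As m < 0, the assumption v(z) >= m gives z^2 + z value at least 2m = v(E), but [hval_linear_lt]
   puts it below v(E). *)
have : ((m *+ 2)%:E <= hval (z ^+ 2 + z)%R)%E.
  apply: hval_geD; last first.
    by apply: le_trans ad_z; rewrite lee_fin mulr2n; lra.
  by rewrite expr2 hvalM mulr2n EFinD leeD.
rewrite zE -vE leNgt hval_linear_lt// !rpredD ?rpredM ?rpredX//.
Qed.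

(** Division by c1 reduces this to [hval_eta_lt] with d = c0 / c1. Up to terms of value at least
    v(w) - (3/4)/2^n, with w = c0 + c1 a, the left-hand element is the slope q built in
    [closer_linear]. *)
Lemma hval_pencil_lt a1 c0 c1 : a1 \in K -> c0 \in K -> c1 \in K ->
  c0 + c1 * a != 0 ->
  (hval (a1 + c1 * y + c0 * a + c1 * e)%R < hval (c0 + c1 * a)%R)%E.
Proof.
move=> a1K c0K c1K; have [->|c10] := eqVneq c1 0.
  by rewrite !mul0r !addr0 => c00; apply: hval_linear_lt.
move=> _; have [m [c1m _ _]] := hval_fin c10.
have -> : a1 + c1 * y + c0 * a + c1 * e
    = c1 * (e + (c0 / c1) * a + (a1 / c1 + y)) by field.
have -> : c0 + c1 * a = c1 * (a + c0 / c1) by field.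
by rewrite !hvalM c1m lteD2lE// hval_eta_lt ?rpredD ?rpred_div.
Qed.

(** Replacing e by s a + r from [eta_root] turns theta into b = p + q a with v(theta - b) = v(w) +
    v(e)/2^n. Once v(q) is below this, every c in K has v(b - c) < v(q) < v(theta - b), hence is
    farther from theta than b. *)
Lemma closer_linear a0 a1 c0 c1 :
  [/\ a0 \in K, a1 \in K, c0 \in K & c1 \in K] -> c0 + c1 * a != 0 ->
  let theta := a0 + a1 * a + (c0 + c1 * a) * e in
  exists p q, [/\ p \in K, q \in K, q != 0 &
    forall c, c \in K -> (hval (theta - c)%R < hval (theta - (p + q * a))%R)%E].
Proof.
move=> [a0K a1K c0K c1K] w0 theta; have Gw := hval_pencil_lt a1K c0K c1K w0.
set w := c0 + c1 * a in w0 Gw theta *; set G := a1 + _ + _ + _ in Gw.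
have [h [wh _ _]] := hval_fin w0.
have G0 : G != 0 by apply: contraTneq Gw => ->; rewrite hval0 ltNge leey.
have [g [Gg _ _]] := hval_fin G0.
move: Gw; rewrite wh Gg lte_fin => gh.
have c1h : (h%:E <= hval c1)%E.
  have [->|c10] := eqVneq c1 0; first by rewrite hval0 leey.
  by rewrite -wh ltW// hval_linear_lt.
(* Since v(e) = -3/4, this n makes v(theta - b) exceed v(G). *)
have [n nP] : exists n, 3 / 4 / 2 ^+ n < h - g :> rat.
  by apply: archi_div2X; rewrite subr_gt0.
have n0 : 0 < 2 ^- n :> rat by rewrite invr_gt0 exprn_gt0.
have [s [r [sK rK sE rE]]] := eta_root n.
have vs := hval_root sE hval_a; have vr := hval_root rE hval_e.
(* Expansion of a0 + a1 a + w (s a + r) by a^2 = a + y. *)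
pose p := a0 + c0 * r + c1 * s * y.
pose q := a1 + c0 * s + c1 * r + c1 * s.
have pK : p \in K by rewrite !rpredD ?rpredM.
have qK : q \in K by rewrite !rpredD ?rpredM.
have bE : theta - (p + q * a) = w * (e + (s * a + r)).
  rewrite hoppr; apply: (@eq_mod2 _ _ (a0 + a1 * a)).
  rewrite /theta /p /q /w.
  have -> : (c0 + c1 * a) * (e + (s * a + r)) = (c0 + c1 * a) * e + c0 * s * a
     + c1 * s * a ^+ 2 + c0 * r + c1 * r * a by ring.
  by rewrite aE; ring.
have GE : G = q + (w + c1) * (a + s) + c1 * (e + (s * a + r)).
  apply/esym; apply: (@eq_mod2 _ _ (c0 * s + c1 * r + c1 * s + c1 * s * a + c1 * a)).
  rewrite /G /q /w.
  have -> : (c0 + c1 * a + c1) * (a + s) = c0 * a + c0 * s + c1 * a ^+ 2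
    + c1 * a * s + c1 * a + c1 * s by ring.
  by rewrite aE; ring.
have vb : hval (theta - (p + q * a)) = (h - 3 / 4 / 2 ^+ n)%:E.
  by rewrite bE hvalM wh vr -EFinD; congr _%:E; lra.
have q_small : (hval q < (h - 3 / 4 / 2 ^+ n)%:E)%E.
  rewrite ltNge; apply/negP => hq.
  suff : (g%:E < hval G)%E by rewrite Gg ltxx.
  rewrite GE; apply: hval_gtD; first apply: hval_gtD.
  - by apply: lt_le_trans hq; rewrite lte_fin; lra.
  - rewrite hvalM vs; apply: (@lt_le_trans _ _ (h%:E + (- (1 / 2) / 2 ^+ n)%:E)%E).
      by rewrite -EFinD lte_fin; lra.
    by apply: leeD => //; apply: hval_geD; rewrite // wh.
  - rewrite hvalM vr; apply: (@lt_le_trans _ _ (h%:E + (- (3 / 4) / 2 ^+ n)%:E)%E).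
      by rewrite -EFinD lte_fin; lra.
    by apply: leeD.
have q0 : q != 0.
  by apply: contraTneq q_small => ->; rewrite hval0 ltNge leey.
exists p, q; split=> // c cK; rewrite ltNge; apply/negP => bc.
have : (hval (theta - (p + q * a))%R <= hval (p + q * a - c)%R)%E.
  have -> : p + q * a - c = (theta - c) - (theta - (p + q * a)) by ring.
  exact: hval_geB.
rewrite vb addrAC => /le_lt_trans /(_ (hval_linear_lt (rpredB pK cK) qK q0)).
by rewrite ltNge (ltW q_small).
Qed.

(** * Elements of K + K a and their degrees *)

Lemma y_neq0 : y != 0.
Proof. by rewrite -hval_eqy vy. Qed.

Lemma notin_of_hval_lt0 x : (forall c, c \in K -> (hval (x + c)%R < 0)%E) -> x \notin K.
Proof. by move=> x0; apply/negP => /x0; rewrite -[x in x + _]hoppr addNr hval0. Qed.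

Lemma a_notinK : a \notin K. Proof. exact: notin_of_hval_lt0. Qed.

(** The conjugate of p + q a is p + q a + q, which gives the trace and norm used as coefficients. *)
Lemma linear_degree p q : p \in K -> q \in K -> q != 0 ->
  algebraic_over K (p + q * a) /\ degree_over K (p + q * a) = 2%N.
Proof.
move=> pK qK q0; apply: (@quadratic_degree _ _ _ q (p ^+ 2 + q ^+ 2 * y + p * q)).
- apply: contra a_notinK => bK.
  have -> : a = (p + q * a - p) / q by field.
  by rewrite rpred_div ?rpredB.
- by [].
- by rewrite !(rpredD, rpredM, rpredX).
- apply: (@eq_mod2 _ _ (p ^+ 2 + q ^+ 2 * (y + a) + p * q + p * q * a)).
  have -> : (p + q * a) ^+ 2 = p ^+ 2 + q ^+ 2 * a ^+ 2 + 2%:R * (p * q * a) by ring.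
  by rewrite aE; ring.
Qed.

Lemma e_linear_neq0 p q : p \in K -> q \in K -> e != p + q * a.
Proof.
move=> pK qK; have := hval_eta_lt pK qK; apply: contraTneq => ->.
have -> : p + q * a + q * a + p = 2%:R * (p + q * a) by ring.
by rewrite two0 mul0r hval0 ltNge leey.
Qed.

Lemma y_root n : exists2 z, z \in K & z ^+ (2 ^ n) = y.
Proof.
elim: n => [|n [z zK zE]]; first by exists y.
by have [w wK wE] := sqrtK zK; exists w; rewrite // expnS exprM wE.
Qed.

(** For n = 1, comparing (a + s)^2 = a with a^2 = a + y gives s^2 = y. The resulting quadratic
    element is closer to e than v(a) = -1/2, the threshold for cubic elements. *)
Lemma eta_root1 : exists s r, [/\ s \in K, r \in K, hval s = (- (1 / 2))%:E &
  hval (e - (r + s * a)) = (- (3 / 8))%:E].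
Proof.
have [s [r [sK rK sE rE]]] := eta_root 1; exists s, r; split=> //.
  have sy : s ^+ (2 ^ 1) = y.
    have -> : s ^+ (2 ^ 1) = (a + s) ^+ (2 ^ 1) - a ^+ 2.
      by rewrite hsqrD addrC addKr.
    by rewrite sE aE hoppr; apply: (@eq_mod2 _ _ a); ring.
  by rewrite (hval_root sy vy); congr _%:E; lra.
by rewrite hoppr [r + _]addrC (hval_root rE hval_e); congr _%:E; lra.
Qed.

(** * Cubic elements and the degree of e *)

Hypothesis hK : henselian K.

(* The three conjugates of b over K would be as close to e as b, hence so would
   be their mean, which lies in K. *)
Lemma eta_far_from_cubic b : ((- (1 / 2))%:E < hval (e - b)%R)%E ->
  degree_over K b != 3%N.
Proof.
move=> eb; apply/eqP => /degree_over_eq3[p [q [r [pK qK rK bE noroot]]]].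
have ep0 : e + p != 0.
  have := e_linear_neq0 pK (rpred0 _); rewrite mul0r addr0.
  by rewrite -subr_eq0 hoppr.
have [m [epm _ _]] := hval_fin ep0.
have := hval_eta_lt pK (rpred0 _); rewrite mul0r !addr0 epm hval_a lte_fin => m12.
(* This places g strictly between m = v(e + p) and -1/2. *)
have [n nP] : exists n, 1 / 2 / 2 ^+ n < - (1 / 2) - m :> rat.
  by apply: archi_div2X; lra.
have n0 : 0 < 2 ^- n :> rat by rewrite invr_gt0 exprn_gt0.
have [s1 [r1 [s1K r1K vs1 vr1]]] := eta_root1.
have [s sK sE] := alpha_root n; have vs := hval_root sE hval_a.
have [z zK zE] := y_root n.+1; have vz := hval_root zE vy.
(* Both c and u lie in K, with v(e + c) = v(u) = g, so that (b + c)/u has value 0. *)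
pose c := r1 + s1 * s; pose u := s1 * z; pose g : rat := - (1 / 2) - 1 / 2 / 2 ^+ n.
have cK : c \in K by rewrite rpredD ?rpredM.
have uK : u \in K by rewrite rpredM.
have ug : hval u = g%:E.
  rewrite hvalM vs1 vz -EFinD; congr _%:E; rewrite /g exprS invfM; lra.
have ecg : hval (e + c) = g%:E.
  have -> : e + c = s1 * (a + s) + (e - (r1 + s1 * a)).
    by rewrite hoppr; apply/esym; apply: (@eq_mod2 _ _ (s1 * a)); rewrite /c; ring.
  have v1 : hval (s1 * (a + s)) = g%:E.
    by rewrite hvalM vs1 vs -EFinD; congr _%:E; rewrite /g; lra.
  by rewrite hvalDl v1// vr1 lte_fin /g; lra.
have bcg : hval (b + c) = g%:E.
  have -> : b + c = (e + c) - (e - b) by ring.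
  rewrite hvalDl ecg// hvalN; apply: lt_trans eb; rewrite lte_fin /g; lra.
have u0 : u != 0 by rewrite -hval_eqy ug.
have x0 : hval ((b + c) / u) = 0%E.
  by rewrite hvalM (hvalV ug) bcg -EFinD subrr.
(* Coefficients of the monic cubic of (b + c)/u, obtained by the substitution X -> u X - c. *)
pose p' := (p - 3%:R * c) / u.
pose q' := (3%:R * c ^+ 2 - 2%:R * p * c + q) / u ^+ 2.
pose r' := (p * c ^+ 2 - c ^+ 3 - q * c + r) / u ^+ 3.
have cubicE x : x ^+ 3 + p' * x ^+ 2 + q' * x + r'
    = ((u * x - c) ^+ 3 + p * (u * x - c) ^+ 2 + q * (u * x - c) + r) / u ^+ 3.
  by rewrite /p' /q' /r'; field.
have : (0 <= hval p')%E.
  apply: (hval_cubic_coef hK _ _ _ x0 (q := q') (r := r')).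
  - by rewrite rpred_div ?rpredB ?rpredM ?rpred_nat.
  - by rewrite rpred_div ?rpredX// rpredD ?rpredB ?rpredM ?rpredX ?rpred_nat.
  - by rewrite rpred_div ?rpredX// rpredD ?rpredB ?rpredM ?rpredX.
  - by rewrite cubicE [u * _]mulrC divfK// addrK bE mul0r.
  - move=> x xK; rewrite cubicE mulf_neq0 ?invr_neq0 ?expf_neq0// noroot//.
    by rewrite rpredB ?rpredM.
(* Thus v(p - 3 c) >= g. As 3 = 1, p is the mean of the conjugates, and v(e + p) >= g > m is the
   contradiction. *)
rewrite hvalM (hvalV ug) EFinN sube_ge0// => gp.
suff : (m%:E < hval (e + p)%R)%E by rewrite epm ltxx.
have -> : e + p = (e + c) + (p - 3%:R * c).
  by apply/esym; apply: (@eq_mod2 _ _ (- c)); ring.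
apply: (@lt_le_trans _ _ g%:E); first by rewrite lte_fin /g; lra.
by apply: hval_geD; rewrite ?ecg.
Qed.

Lemma e_degree : algebraic_over K e /\ degree_over K e = 4%N.
Proof.
(* With T = X^2 + X this quartic is T^2 + y T + y^3, the product of T + y a and its conjugate T + y
   (a + 1). *)
have [|||ea le4] := @degree_over_seq _ K e [:: y ^+ 3; y; 1 + y; 0; 1].
- by rewrite /= ?(rpredD, rpredX, rpred0, rpred1) ?yK.
- exact: oner_neq0.
- have -> : horner_rec [:: y ^+ 3; y; 1 + y; 0; 1] e
      = (e ^+ 2) ^+ 2 + y * (e ^+ 2 + e) + e ^+ 2 + y ^+ 3 by rewrite /=; ring.
  rewrite eE hsqrD exprMn eE aE.
  by apply: (@eq_mod2 _ _ (e + y * a + y * e + y ^+ 2 * a + y ^+ 3)); ring.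
split=> //; apply/eqP; rewrite eqn_leq le4 ltn_neqAle eq_sym.
rewrite eta_far_from_cubic ?subrr ?hval0 ?ltry//= ltn_neqAle eq_sym.
rewrite degree_over_gt1// ?andbT; last first.
  by apply/negP => /e_linear_neq0/(_ (rpred0 _)); rewrite mul0r addr0 eqxx.
(* Substituting e^2 leaves (1 + p) e + y a + q = 0, which puts a in K or e in K + K a. *)
apply/eqP => /degree_over_eq2[p [q [pK qK]]]; rewrite eE => pq.
have [p1|p1] := eqVneq (1 + p) 0.
  have yaq : y * a + q = 0.
    have -> : y * a + q = (e + y * a + p * e + q) - (1 + p) * e by ring.
    by rewrite pq p1 mul0r subrr.
  have /negP := a_notinK; apply.
  have -> : a = - q / y.
    rewrite -[a](mulKf y_neq0) mulrC; congr (_ / _); apply/eqP.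
    by rewrite -addr_eq0 yaq.
  by rewrite rpred_div ?rpredN.
have K1p : 1 + p \in K by rewrite rpredD ?rpred1.
have := @e_linear_neq0 (- q / (1 + p)) (- y / (1 + p)).
rewrite !rpred_div ?rpredN// => /(_ isT isT)/eqP; apply.
apply: (mulfI p1); rewrite -[LHS]subr0 -pq.
by field.
Qed.

(** * The depth of e and of the other generators of M *)

Lemma next_d1 a0 a1 c0 c1 :
  [/\ a0 \in K, a1 \in K, c0 \in K & c1 \in K] -> c0 + c1 * a != 0 ->
  next_d K (a0 + a1 * a + (c0 + c1 * a) * e) 1 = 2%N.
Proof.
move=> cK w0; have [p [q [pK qK q0 pqP]]] := closer_linear cK w0.
have [pqa pqd] := linear_degree pK qK q0.
apply: least_eq => [|m []//]; split=> //.
exists (hval (a0 + a1 * a + (c0 + c1 * a) * e - (p + q * a))).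
  by exists (p + q * a).
by move=> _ [c [_ /degree_over_eq1 cK1] <-]; apply: pqP.
Qed.

Lemma depth_e : depth K e = 2%N.
Proof.
have [ea ed] := e_degree.
have nd1 : next_d K e 1 = 2%N.
  have := @next_d1 0 0 1 0; rewrite !mul0r !add0r addr0 mul1r; apply.
    by rewrite rpred0 rpred1.
  exact: oner_neq0.
have nd2 : next_d K e 2 = 4%N.
  have := @next_d_bounds _ K e 2%N ea; rewrite ed => /(_ isT) /andP[lo hi].
  apply/eqP; rewrite eqn_leq hi ltn_neqAle lo andbT; apply/eqP => e3.
  (* The value 3 is not the default of [least], so some cubic element is closer to e than r + s a,
     at value above -3/8 > -1/2. *)
  have [|] := @least_gt0P [set m | (2 < m)%N /\
   exists2 x : \bar rat, Dset K e m x & forall t, Dset K e 2 t -> (t < x)%E]%classic.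
    by rewrite -/(next_d K e 2) -e3.
  rewrite -/(next_d K e 2) -e3 => -[_ [x [b [_ b3] <-]]] + _.
  have [s [r [sK rK vs vr]]] := eta_root1.
  have s0 : s != 0 by rewrite -hval_eqy vs.
  have [sa sd] := linear_degree rK sK s0.
  move=> /(_ (hval (e - (r + s * a)))) => /(_ (ex_intro2 _ _ _ (conj sa sd) erefl)).
  rewrite vr => eb; move: b3; apply/eqP/eta_far_from_cubic.
  by apply: lt_trans eb; rewrite lte_fin; lra.
apply: least_eq => /=; first by rewrite nd1 nd2 ed.
by move=> [|[|n]] //=; rewrite ed ?nd1.
Qed.

Lemma adjoin_a x : x \in adjoin K a <->
  exists p q, [/\ p \in K, q \in K & x = p + q * a].
Proof.
apply: (adjoin_quadratic (p := 1) (q := y)); rewrite ?rpred1 ?a_notinK//.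
by rewrite aE mul1r; apply: (@eq_mod2 _ _ (a + y)); ring.
Qed.

Lemma e_notin_adjoin : e \notin adjoin K a.
Proof. by apply/negP => /adjoin_a[p [q [pK qK /eqP]]]; apply/negP/e_linear_neq0. Qed.

Lemma adjoin_ae x : x \in adjoin (adjoin K a) e <-> exists a0 a1 c0 c1,
  [/\ a0 \in K, a1 \in K, c0 \in K & c1 \in K] /\
  x = a0 + a1 * a + (c0 + c1 * a) * e.
Proof.
have yaL : y * a \in adjoin K a.
  by apply/adjoin_a; exists 0, y; rewrite rpred0 add0r.
rewrite (adjoin_quadratic (p := 1) (q := y * a)) ?rpred1 ?e_notin_adjoin//; last first.
  by rewrite eE mul1r; apply: (@eq_mod2 _ _ (e + y * a)); ring.
split=> [[_ [_ [/adjoin_a[a0 [a1 [? ? ->]]] /adjoin_a[c0 [c1 [? ? ->]]] ->]]]|].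
  by exists a0, a1, c0, c1.
move=> [a0 [a1 [c0 [c1 [[? ? ? ?] ->]]]]]; exists (a0 + a1 * a), (c0 + c1 * a).
by split=> //; apply/adjoin_a; [exists a0, a1|exists c0, c1].
Qed.

Lemma adjoin_e : adjoin K e =i adjoin (adjoin K a) e.
Proof.
move=> x; apply/idP/idP; apply: adjoin_sub; rewrite ?mem_adjoin//.
  by move=> z zK; apply/sub_adjoin/sub_adjoin.
apply: adjoin_sub; first exact: sub_adjoin.
have -> : a = (e ^+ 2 - e) / y.
  by rewrite eE addrC addKr mulrC mulKf// y_neq0.
have eK : e \in adjoin K e by apply: mem_adjoin.
apply: rpred_div; last exact: sub_adjoin.
by apply: rpredB => //; apply: rpredX.
Qed.

Lemma depth_tower : depth_ext K (adjoin (adjoin K a) e) = 2%N.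
Proof.
apply: least_eq.
  by exists e; split; [exact: e_degree.1|exact: adjoin_e|exact: depth_e].
move=> _ [theta [ta tM <-]].
have tL : theta \notin adjoin K a.
  apply/negP => tL; have /negP := e_notin_adjoin; apply.
  by apply: (adjoin_sub (@sub_adjoin _ K a) tL); rewrite tM mem_adjoin.
have tnK : theta \notin K by apply: contra tL; apply: sub_adjoin.
have /adjoin_ae[a0 [a1 [c0 [c1 [cK tE]]]]] : theta \in adjoin (adjoin K a) e.
  by rewrite -tM mem_adjoin.
apply: depth_gt1 => //.
  rewrite tE next_d1//; apply: contra tL => /eqP w0; apply/adjoin_a.
  by exists a0, a1; case: cK => ? ? _ _; rewrite tE w0 mul0r addr0.
rewrite ltn_neqAle eq_sym degree_over_gt1// andbT.
apply/eqP => /degree_over_eq2[p [q [pK qK pq]]].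
(* If theta had degree 2, then a = c + d theta with d nonzero, which would put theta in K(a). *)
have : a \in adjoin K theta by rewrite tM; apply/sub_adjoin/mem_adjoin.
move=> /(adjoin_quadratic pK qK tnK pq)[c [d [cK' dK aE']]].
have d0 : d != 0.
  by apply: contraNneq a_notinK => d0; rewrite aE' d0 mul0r addr0.
move/negP: tL; apply; apply/adjoin_a; exists (- c / d), d^-1.
rewrite rpred_div ?rpredN ?rpredV//; split=> //.
by rewrite aE'; field.
Qed.

End ArtinSchreierTower.

Theorem lemma4p4 (R : realType) (k : closedFieldType)
    (K : divringClosed {hahn k}) :
  2%N \in [pchar k] ->
  {subset kY k <= K} ->
  henselian K ->
  perfect_field K ->
  no_finite_limits R K ->
  let L := adjoin K (alpha k) in
  let M := adjoin L (eta k) in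
  depth_ext K M = 2%N.
Proof.
move=> k2 kYK hK pK nfl L M.
(* The y of the tower is the monomial y^-1. *)
have yK : hmono 1 (- 1) \in K.
  have -> : hmono 1 (- 1) = (hmono 1 1)^-1 :> {hahn k}.
    apply: (@mulfI _ (hmono 1 1)); first by rewrite -hval_eqy hval_mono.
    by rewrite hmono_mul mul1r subrr divff// -hval_eqy hval_mono.
  by rewrite rpredV; apply: kYK; apply/asboolP => E; apply; right.
apply: (depth_tower k2 yK) => //.
- exact: hval_mono.
- by move=> x; apply: pK; apply: hpchar2.
- by rewrite -(alphaE k2) addrC subrK.
- by rewrite -(etaE k2) addrCA (addrr_pchar2 (hpchar2 k2)) addr0.
- by move=> c; apply: hval_alphaD_lt0 nfl.
Qed.
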